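(* Let $\Gamma<\mathrm U(2,1)$ be a lattice, and suppose that $\Gamma$ is commensurable with a lattice $\Lambda$ containing a complex reflection. Then $\Gamma$ is either arithmetic of first type or nonarithmetic.
   Context: Let $V$ be a 3-dimensional complex vector space with a hermitian form $h$ of signature $(2,1)$, and $\mathrm U(2,1)$ its unitary group. A complex reflection is a finite-order diagonalizable $R\in\mathrm U(2,1)$ with eigenvalue $1$ of multiplicity $2$ and third eigenvalue a root of unity $\eta\neq1$, whose $\eta$-eigenspace is an $h$-positive line. Arithmeticity. Let $F$ be a totally real number field, $E$ a totally imaginary quadratic extension of $F$, and $\mathcal D$ either $E$ ($d=1$) or a cubic division algebra with center $E$ ($d=3$), with an involution $\tau$ restricting to the Galois involution of $E/F$ on $E$. Put $r=3/d$ and let $h'$ be a $\tau$-hermitian form on $\mathcal D^r$ such that, for exactly one real embedding $\iota$ of $F$, the unitary group $\mathrm U(\iota(h'))$ is noncompact, and this group is isomorphic to $\mathrm U(2,1)$. For an order $\mathcal O$ of $\mathcal D$, let $\Gamma_{\mathcal O}$ be the subgroup of $\mathrm{GL}_r(\mathcal O)$ preserving $h'$. A lattice in $\mathrm{PU}(2,1)$ is arithmetic if it is commensurable with the image of some such $\Gamma_{\mathcal O}$; a lattice in $\mathrm U(2,1)$ is arithmetic if its image in $\mathrm{PU}(2,1)$ is, and nonarithmetic otherwise. An arithmetic lattice is of first type if $\mathcal D=E$ (so $h'$ is a hermitian form on $E^3$), and of second type if $\mathcal D$ is a cubic division algebra. *)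

(* Defs.v *)
From HB Require Import structures.
From mathcomp Require Import all_boot all_order all_algebra all_field.
From mathcomp Require Import all_classical all_reals all_analysis.
From mathcomp.real_closed Require Import complex.

Set Implicit Arguments.
Unset Strict Implicit.
Unset Printing Implicit Defensive.

Import Order.TTheory GRing.Theory Num.Theory.
Import numFieldNormedType.Exports.

Local Open Scope classical_set_scope.
Local Open Scope ring_scope.
Local Open Scope sesquilinear_scope.

(* [R[i]] itself carries no topology in the library; read as a
   [numClosedFieldType] it has the metric topology of the modulus, and ['M_n]
   over it the product topology. *)
Definition Cplx (R : realType) : numClosedFieldType := R[i].

(* Vectors are rows and matrices act on the right.  For an anti-automorphism s,
   the matrix H stands for the form h(u, v) = u *m H *m v ^t s, which is
   s-hermitian iff H ^t s = H; the matrix g preserves h iff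
   g *m H *m g ^t s = H. *)
Definition unitary (A : pzRingType) (s : A -> A) (n : nat) (H : 'M[A]_n) :
    set 'M[A]_n :=
  [set g | (exists g' : 'M[A]_n, g *m g' = 1%:M /\ g' *m g = 1%:M)
         /\ g *m H *m (g ^t s) = H].

(* Existence of a basis (the rows of P) that is orthogonal for h, with values
   1, 1, -1 of h on its members. *)
Definition signature21 (R : realType) (H : 'M[Cplx R]_3) : Prop :=
  H \is hermsymmx /\
  exists2 P : 'M[Cplx R]_3, P \in unitmx &
    P *m H *m P ^t* = diag_mx (\row_(j < 3) if j == ord_max then -1 else 1).

Definition U21 (R : realType) (H : 'M[Cplx R]_3) : set 'M[Cplx R]_3 :=
  unitary Num.conj H.

Definition complex_reflection (R : realType) (H g : 'M[Cplx R]_3) : Prop :=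
  [/\ U21 H g,
      exists2 n, (0 < n)%N & g ^+ n = 1,
      diagonalizable g,
      \rank (eigenspace g 1) = 2%N &
      exists eta : Cplx R,
        [/\ eta != 1,
            exists2 m, (0 < m)%N & eta ^+ m = 1,
            \rank (eigenspace g eta) = 1%N &
            forall v : 'rV[Cplx R]_3, (v <= eigenspace g eta)%MS -> v != 0 ->
              0 < (v *m H *m v ^t*) 0 0]].

Definition finite_index (T : Type) (mul : T -> T -> T) (A B : set T) : Prop :=
  finite_set [set [set mul a b | b in B] | a in A].

(* For subgroups A and B of a group with multiplication mul. *)
Definition commensurable (T : Type) (mul : T -> T -> T) (A B : set T) : Prop :=
  finite_index mul A (A `&` B) /\ finite_index mul B (A `&` B).

Definition subgroup (R : realType) (G Gamma : set 'M[Cplx R]_3) : Prop :=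
  [/\ Gamma `<=` G,
      Gamma 1%:M,
      forall a b, Gamma a -> Gamma b -> Gamma (a *m b) &
      forall a, Gamma a -> Gamma (invmx a)].

Definition discrete_subgroup (R : realType) (Gamma : set 'M[Cplx R]_3) : Prop :=
  \forall g \near (1%:M : 'M[Cplx R]_3), Gamma g -> g = 1%:M.

Definition translate (R : realType) (X : set 'M[Cplx R]_3) (g : 'M[Cplx R]_3) :
    set 'M[Cplx R]_3 :=
  [set g *m x | x in X].

Definition quotient_space (R : realType) (G Gamma : set 'M[Cplx R]_3) :
    set (set 'M[Cplx R]_3) :=
  [set translate Gamma g | g in G].

(* The quotient topology on G / Gamma, where G has the subspace topology. *)
Definition quotient_open (R : realType) (G Gamma : set 'M[Cplx R]_3) :
    set (set (set 'M[Cplx R]_3)) :=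
  [set W | W `<=` quotient_space G Gamma /\
           exists2 O : set 'M[Cplx R]_3, open O &
             G `&` translate Gamma @^-1` W = G `&` O].

(* A discrete subgroup Gamma such that G / Gamma carries a nonzero finite
   G-invariant Borel measure.  The measure nu lives on the type of all sets of
   matrices and is concentrated on the subset G / Gamma. *)
Definition lattice_in (R : realType) (G Gamma : set 'M[Cplx R]_3) : Prop :=
  [/\ subgroup G Gamma, discrete_subgroup Gamma &
      exists nu : {measure set (g_sigma_algebraType (quotient_open G Gamma))
                   -> \bar R},
        [/\ nu (~` quotient_space G Gamma) = 0%E,
            (0 < nu (quotient_space G Gamma) < +oo)%E &
            forall g (A : set (g_sigma_algebraType (quotient_open G Gamma))),
              G g -> measurable A ->
              nu [set translate X g | X in A] = nu A]].

Definition lattice (R : realType) (H : 'M[Cplx R]_3) (Gamma : set 'M[Cplx R]_3)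
    : Prop :=
  lattice_in (U21 H) Gamma.

(* The points of PU(2,1) are the cosets of the center of U(2,1), i.e. of the
   scalars of modulus 1; they are multiplied as subsets of U(2,1). *)
Definition pu_class (R : realType) (g : 'M[Cplx R]_3) : set 'M[Cplx R]_3 :=
  [set z *: g | z in [set z : Cplx R | `|z| = 1]].

Definition pu_mul (R : realType) (X Y : set 'M[Cplx R]_3) :
    set 'M[Cplx R]_3 :=
  [set x *m y | x in X & y in Y].

Definition topgroup_iso (S T : topologicalType) (f : S -> T)
    (mulS : S -> S -> S) (mulT : T -> T -> T) (G : set S) (G' : set T) : Prop :=
  [/\ set_bij G G' f,
      forall x y, G x -> G y -> f (mulS x y) = mulT (f x) (f y),
      {within G, continuous f} &
      exists2 f' : T -> S,
        (forall x, G x -> f' (f x) = x) & {within G', continuous f'}].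

Definition totally_real (R : realType) (F : fieldExtType rat) : Prop :=
  forall (s : {rmorphism F -> Cplx R}) (x : F), s x \is Num.real.

Definition totally_imaginary_quadratic (R : realType) (F : fieldExtType rat)
    (E : fieldExtType F) : Prop :=
  \dim {:E} = 2%N /\
  forall s : {rmorphism E -> Cplx R}, exists x : E, s x \isn't Num.real.

Definition galois_involution (F : fieldExtType rat) (E : fieldExtType F)
    (c : {rmorphism E -> E}) : Prop :=
  (forall x : F, c x%:A = x%:A) /\ (exists x : E, c x != x).

(* A division algebra of degree d (dimension d ^ 2) over its center E.  For
   d = 1 this says that D = E. *)
Definition central_division_algebra (F : fieldExtType rat)
    (E : fieldExtType F) (D : falgType E) (d : nat) : Prop :=
  [/\ forall x : D, x != 0 -> x \is a GRing.unit,
      forall x : D, (forall y : D, x * y = y * x) -> exists e : E, x = e%:A &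
      \dim {:D} = (d ^ 2)%N].

Definition involution_over (F : fieldExtType rat) (E : fieldExtType F)
    (D : falgType E) (c : {rmorphism E -> E}) (tau : D -> D) : Prop :=
  [/\ forall x y, tau (x + y) = tau x + tau y,
      forall x y, tau (x * y) = tau y * tau x,
      forall x, tau (tau x) = x &
      forall e : E, tau e%:A = (c e)%:A].

(* A presentation of the real algebra with involution D (x)_(F, iota) R, for D
   central of degree k.+1 over E.  As E (x)_(F, iota) R is C through an embedding
   sigma of E over iota, this algebra is D (x)_(E, sigma) C, which is isomorphic
   to M_(k.+1)(C); extm is x |-> x (x) 1, and extt is the C-antilinear extension
   of tau.  By dimension count, [extm_span] makes the induced C-linear map
   D (x)_(E, sigma) C -> M_(k.+1)(C) bijective.  All presentations over a given
   iota yield isomorphic algebras with involution. *)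
Record real_extension (R : realType) (F : fieldExtType rat)
    (E : fieldExtType F) (D : falgType E) (tau : D -> D) (k : nat)
    (iota : {rmorphism F -> R}) := RealExtension {
  exts : {rmorphism E -> Cplx R};
  exts_iota : forall x : F, exts x%:A = (iota x)%:C%C;
  extm : {rmorphism D -> 'M[Cplx R]_k.+1};
  extm_scalar : forall e : E, extm e%:A = (exts e)%:M;
  extm_span : forall A : 'M[Cplx R]_k.+1,
    exists n (z : 'I_n -> Cplx R) (x : 'I_n -> D),
      A = \sum_(i < n) z i *: extm (x i);
  extt : 'M[Cplx R]_k.+1 -> 'M[Cplx R]_k.+1;
  exttD : forall A B, extt (A + B) = extt A + extt B;
  exttZ : forall z A, extt (z *: A) = z^* *: extt A;
  exttM : forall A B, extt (A *m B) = extt B *m extt A;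
  extt_tau : forall x : D, extt (extm x) = extm (tau x)
}.

(* The group U(iota(h')), where h' has matrix H on D^r. *)
Definition real_unitary (R : realType) (F : fieldExtType rat)
    (E : fieldExtType F) (D : falgType E) (tau : D -> D) (k : nat)
    (iota : {rmorphism F -> R}) (X : real_extension tau k iota)
    (r : nat) (H : 'M[D]_r) : set 'M['M[Cplx R]_k.+1]_r :=
  unitary (extt X) (map_mx (extm X) H).

(* A subring that is finitely generated as a Z-module and spans D over Q. *)
Definition is_order (F : fieldExtType rat) (E : fieldExtType F)
    (D : falgType E) (O : set D) : Prop :=
  [/\ O 1,
      forall x y, O x -> O y -> O (x - y),
      forall x y, O x -> O y -> O (x * y),
      exists n (b : 'I_n -> D),
        forall x, O x <-> exists c : 'I_n -> int, x = \sum_(i < n) b i *~ c i &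
      forall x, exists2 n, (0 < n)%N & O (x *+ n)].

Definition arithmetic_group (F : fieldExtType rat) (E : fieldExtType F)
    (D : falgType E) (tau : D -> D) (r : nat) (H : 'M[D]_r) (O : set D) :
    set 'M[D]_r :=
  [set g : 'M[D]_r |
           [/\ forall i j, O (g i j),
               exists g' : 'M[D]_r,
                 [/\ forall i j, O (g' i j), g *m g' = 1%:M & g' *m g = 1%:M] &
               g *m H *m (g ^t tau) = H]].

(* The data of the definition of arithmeticity, with D of degree d = k.+1 over
   E and r = 3 / d.  The real embedding of F whose unitary group is noncompact
   is iota, and the image in PU(2,1) is taken through an isomorphism f of
   topological groups from U(iota(h')) to U(2,1), the unitary group of H.  That
   h' is nondegenerate follows from the existence of f. *)
Definition arithmetic_of_degree (k r : nat) (R : realType) (H : 'M[Cplx R]_3)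
    (Gamma : set 'M[Cplx R]_3) : Prop :=
  (k.+1 * r = 3)%N /\
  exists (F : fieldExtType rat) (E : fieldExtType F) (c : {rmorphism E -> E})
         (D : falgType E) (tau : D -> D) (H' : 'M[D]_r),
    [/\ totally_real R F,
        totally_imaginary_quadratic R E,
        galois_involution c,
        central_division_algebra D k.+1 &
        [/\ involution_over c tau,
        H' ^t tau = H' &
        exists (iota : {rmorphism F -> R}) (X : real_extension tau k iota)
               (f : 'M['M[Cplx R]_k.+1]_r -> 'M[Cplx R]_3) (O : set D),
          [/\ forall (kappa : {rmorphism F -> R})
                     (Y : real_extension tau k kappa),
                ~ compact (real_unitary Y H') <-> kappa =1 iota,
              topgroup_iso f mulmx mulmx (real_unitary X H') (U21 H),
              is_order O &
              commensurable (@pu_mul R)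
                [set pu_class g | g in Gamma]
                [set pu_class (f (map_mx (extm X) g))
                  | g in arithmetic_group tau H' O]]]].

Definition arithmetic_first_type (R : realType) (H : 'M[Cplx R]_3)
    (Gamma : set 'M[Cplx R]_3) : Prop :=
  arithmetic_of_degree 0 3 H Gamma.

Definition arithmetic_second_type (R : realType) (H : 'M[Cplx R]_3)
    (Gamma : set 'M[Cplx R]_3) : Prop :=
  arithmetic_of_degree 2 1 H Gamma.

Definition arithmetic (R : realType) (H : 'M[Cplx R]_3)
    (Gamma : set 'M[Cplx R]_3) : Prop :=
  arithmetic_first_type H Gamma \/ arithmetic_second_type H Gamma.

Definition nonarithmetic (R : realType) (H : 'M[Cplx R]_3)
    (Gamma : set 'M[Cplx R]_3) : Prop :=
  ~ arithmetic H Gamma.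

(* Main.v *)
Require Import Defs.
From HB Require Import structures.
From mathcomp Require Import all_boot all_order all_algebra all_field.
From mathcomp Require Import all_classical all_reals all_analysis.
From mathcomp.real_closed Require Import complex.
From mathcomp Require Import ring.

(** Suppose that [Gamma] is arithmetic of second type and let [D] be the division
    algebra.  The isomorphism of the definition gives an injective morphism [phi]
    from [U(2,1)] into the invertible complex 3 by 3 matrices such that, up to
    scalars of modulus 1, a finite index subgroup of [Gamma], and so one of
    [Lambda], is carried into [D], which sits in these matrices.  One derives a
    contradiction from a complex reflection [r] in [Lambda].

    Algebra.  The reflection has finite order and a nonabelian centralizer
    ([reflection_centralizer]).  So [rho = phi r] is diagonalizable with a repeated
    eigenvalue, that is, a scalar plus a matrix of rank at most one
    ([scalar_plus_rank1]).  Let [L] be the subgroup of those [x] that, together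
    with their conjugates by [r], are carried into [D] up to scalars.  For a commutator [x] of
    [L] the scalars cancel, and [phi x] and [rho * phi x / rho] are both in [D].
    Their difference is singular, being the commutator of [rho] and [phi x] up to
    an invertible factor, hence of rank at most 2; as [D] is a division ring, it
    is zero.  So the commutators of [L] commute with [r] ([commutator_comm]).  If
    [rho] is not scalar, their images have a common eigenvector, whose eigenvalue
    determines an element of [D].  Since conjugate matrices have the same finitely
    many eigenvalues, a commutator has only finitely many conjugates under [L].
    Together with two easier cases this gives a nonscalar matrix [n] with finitely
    many conjugates under [L], hence under [Lambda]
    ([finite_conjugates_nonscalar]).

    Dynamics.  This contradicts the existence of a finite invariant measure on the
    quotient by [Lambda] ([lattice_finite_conjugates]).  Let [v] be isotropic.  The
    function [g |-> v (g n g^-1 H) v^*] takes, up to the finite ambiguity of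
    replacing [n] by a conjugate under [Lambda], well defined values on the
    quotient, and is multiplied by 4 under an element of [U(2,1)] that doubles
    [v].  A finite invariant measure is then concentrated on its zeros.  Taking
    finitely many [v] one finds [g] such that the form with matrix [g n g^-1 H]
    vanishes on enough isotropic vectors to be a multiple of [H], so that [n] is
    scalar. *)

Set Implicit Arguments.
Unset Strict Implicit.
Unset Printing Implicit Defensive.

Import Order.TTheory GRing.Theory Num.Theory.
Import numFieldNormedType.Exports.

Local Open Scope classical_set_scope.
Local Open Scope ring_scope.
Local Open Scope sesquilinear_scope.

(** * Unitary groups of hermitian forms *)

Section Hermitian.
Variables (C : numClosedFieldType) (n : nat).
Implicit Types (H g a : 'M[C]_n) (u v : 'rV[C]_n).

Lemma adjmxM m p q (A : 'M[C]_(m, p)) (B : 'M[C]_(p, q)) :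
  (A *m B) ^t* = B ^t* *m A ^t*.
Proof. by rewrite trmx_mul map_mxM. Qed.

Lemma adjmxB m p (A B : 'M[C]_(m, p)) : (A - B) ^t* = A ^t* - B ^t*.
Proof. by apply/matrixP => i j; rewrite !mxE rmorphB. Qed.

Lemma adjmxD m p (A B : 'M[C]_(m, p)) : (A + B) ^t* = A ^t* + B ^t*.
Proof. by apply/matrixP => i j; rewrite !mxE rmorphD. Qed.

Lemma adjmxZ m p z (A : 'M[C]_(m, p)) : (z *: A) ^t* = z^* *: A ^t*.
Proof. by apply/matrixP => i j; rewrite !mxE rmorphM. Qed.

Lemma adjmx1 : (1%:M : 'M[C]_n) ^t* = 1%:M.
Proof. by rewrite trmx1 map_mx1. Qed.

Lemma unitaryE H g :
  unitary Num.conj H g <-> g \in unitmx /\ g *m H *m g ^t* = H.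
Proof.
split=> [[[g' [gg' _]] gH]|[gU gH]]; split=> //; first by case/mulmx1_unit: gg'.
by exists (invmx g); rewrite mulmxV ?mulVmx.
Qed.

Lemma unitary1 H : unitary Num.conj H 1%:M.
Proof.
by apply/unitaryE; rewrite unitmx1 mul1mx trmx1 map_mx1 mulmx1.
Qed.

Lemma unitaryM H a b : unitary Num.conj H a -> unitary Num.conj H b ->
  unitary Num.conj H (a *m b).
Proof.
move=> /unitaryE[aU aH] /unitaryE[bU bH]; apply/unitaryE.
rewrite unitmx_mul aU bU; split=> //.
by rewrite adjmxM !mulmxA -(mulmxA a) -(mulmxA a) bH.
Qed.

Lemma unitaryV H a : unitary Num.conj H a -> unitary Num.conj H (invmx a).
Proof.
move=> /unitaryE[aU aH]; apply/unitaryE; rewrite unitmx_inv; split=> //.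
have e : (invmx a *m a) ^t* = 1%:M by rewrite mulVmx// trmx1 map_mx1.
by rewrite -[in LHS]aH !mulmxA mulVmx// mul1mx -mulmxA -adjmxM e mulmx1.
Qed.

Lemma unitaryZ H z a : `|z| = 1 -> unitary Num.conj H a ->
  unitary Num.conj H (z *: a).
Proof.
move=> z1 /unitaryE[aU aH]; apply/unitaryE.
have z0 : z != 0 by rewrite -normr_eq0 z1 oner_neq0.
rewrite unitmxZ ?unitfE//; split=> //.
rewrite adjmxZ -!scalemxAl -scalemxAr scalerA aH.
by rewrite -normCK z1 expr1n scale1r.
Qed.

Lemma unitaryP H a : H \in unitmx -> a *m H *m a ^t* = H ->
  unitary Num.conj H a.
Proof.
move=> HU aH; apply/unitaryE; split=> //.
have : a *m (H *m a ^t* *m invmx H) = 1%:M by rewrite !mulmxA aH mulmxV.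
by case/mulmx1_unit.
Qed.

(** Take [a] to be the boost that multiplies [v] by [2], [v'] by [1 / 2] and is
    the identity on the orthogonal complement of the hyperbolic plane that they
    span. *)
Lemma isotropic_dilation H (v v' : 'rV[C]_n) :
  H \in unitmx -> H ^t* = H ->
  v *m H *m v ^t* = 0 -> v' *m H *m v' ^t* = 0 -> v *m H *m v' ^t* = 1%:M ->
  exists2 a, unitary Num.conj H a & v *m a = 2 *: v.
Proof.
move=> HU Hh vv v'v' vv'.
have v'v : v' *m H *m v ^t* = 1%:M.
  have := congr1 (fun X : 'M[C]_1 => X ^t*) vv'.
  by rewrite !adjmxM trmxCK Hh mulmxA trmx1 map_mx1.
pose al : 'cV[C]_n := H *m v' ^t*; pose be : 'cV[C]_n := H *m v ^t*.
have va : v *m al = 1%:M by rewrite mulmxA.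
have vb : v *m be = 0 by rewrite mulmxA.
have v'a : v' *m al = 0 by rewrite mulmxA.
have v'b : v' *m be = 1%:M by rewrite mulmxA.
have alE : al ^t* = v' *m H by rewrite adjmxM trmxCK Hh.
have beE : be ^t* = v *m H by rewrite adjmxM trmxCK Hh.
have Hv : H *m v ^t* = be by [].
have Hv' : H *m v' ^t* = al by [].
move: al be va vb v'a v'b alE beE Hv Hv' => al be va vb v'a v'b alE beE Hv Hv'.
pose a : 'M[C]_n := 1%:M + (al *m v - 2^-1 *: (be *m v')).
exists a; last first.
  rewrite /a mulmxDr mulmx1 mulmxBr -scalemxAr !mulmxA va vb mul0mx scaler0.
  by rewrite subr0 mul1mx scaler_nat mulr2n.
apply: unitaryP => //.
have aadj : a ^t* = 1%:M + (v ^t* *m al ^t* - 2^-1 *: (v' ^t* *m be ^t*)).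
  by rewrite adjmxD adjmxB adjmxZ !adjmxM adjmx1 fmorphV rmorph_nat.
have Ha : H *m a ^t* = H + (be *m al ^t* - 2^-1 *: (al *m be ^t*)).
  by rewrite aadj mulmxDr mulmx1 mulmxBr -scalemxAr !mulmxA Hv Hv'.
rewrite -mulmxA Ha /a mulmxDl mul1mx.
rewrite mulmxDr !mulmxBl !mulmxBr -!scalemxAl -!scalemxAr.
rewrite -!(mulmxA _ _ H) -alE -beE -!mulmxA.
rewrite !(mulmxA v) !(mulmxA v') va vb v'a v'b.
rewrite !mul0mx !mul1mx !mulmx0 !scaler0 subr0 sub0r.
set X := al *m _; set Y := be *m _.
rewrite -[RHS]addr0 -addrA; congr (_ + _).
by apply/matrixP => i j; rewrite !mxE; field.
Qed.

End Hermitian.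

(** * Isotropic vectors of the standard form of signature (2,1) *)

Section Isotropic.
Variable C : numClosedFieldType.

Definition row3 (x y z : C) : 'rV[C]_3 := \row_j [:: x; y; z]`_j.

Definition J21 : 'M[C]_3 := diag_mx (\row_(j < 3) if j == ord_max then -1 else 1).

Lemma sum3 (F : 'I_3 -> C) : \sum_(i < 3) F i = F 0 + F 1 + F ord_max.
Proof.
rewrite !big_ord_recl big_ord0 addr0 addrA.
by congr (_ + F _ + F _); exact: val_inj.
Qed.

Lemma row3_form (M : 'M[C]_3) x y z x' y' z' :
  (row3 x y z *m M *m (row3 x' y' z') ^t*) 0 0 =
  (x * M 0 0 + y * M 1 0 + z * M ord_max 0) * x'^* +
  (x * M 0 1 + y * M 1 1 + z * M ord_max 1) * y'^* +
  (x * M 0 ord_max + y * M 1 ord_max + z * M ord_max ord_max) * z'^*.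
Proof.
by rewrite !mxE !sum3 !mxE !sum3 !mxE.
Qed.

(** An expression [A + a x + b x^*] is determined by its values at
    three phases [x]; here they are [1], [-1] and ['i]. *)
Lemma phases3 (A a b : C) :
  A + a + b = 0 -> A - a - b = 0 -> A + 'i * a - 'i * b = 0 ->
  [/\ A = 0, a = 0 & b = 0].
Proof.
move=> e1 e2 e3.
have A0 : A = 0.
  have : 2 * A = 0 by rewrite -[RHS](addr0 0) -{1}e1 -e2; ring.
  by move/eqP; rewrite mulf_eq0 pnatr_eq0 /= => /eqP.
have ab : a + b = 0 by rewrite -e1 A0 add0r.
have : 'i * (a - b) = 0 by rewrite -e3 A0; ring.
move/eqP; rewrite mulf_eq0 (negPf (neq0Ci C)) /= subr_eq0 => /eqP ba.
have : 2 * b = 0 by rewrite -ab ba; ring.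
by move/eqP; rewrite mulf_eq0 pnatr_eq0 /= => /eqP b0; rewrite ba b0.
Qed.

(** Finitely many null vectors [(x, y, 1)], [|x|^2 + |y|^2 = 1], of the standard
    form: enough of them that a sesquilinear form vanishing on all of them
    vanishes on the whole null cone. *)
Definition isotropic_rows : seq 'rV[C]_3 :=
  [:: row3 1 0 1; row3 (-1) 0 1; row3 'i 0 1;
      row3 0 1 1; row3 0 (-1) 1; row3 0 'i 1;
      row3 (3 / 5) (4 / 5) 1; row3 (3 / 5) (4 / 5 * 'i) 1].

(** The vectors with a zero coordinate kill the entries in the last row and
    column outside the diagonal and tie the diagonal entries together; the two
    others, over [(3 / 5, 4 / 5)], kill the remaining entries. *)
Lemma isotropic_rows_span (M : 'M[C]_3) :
  (forall v, v \in isotropic_rows -> (v *m M *m v ^t*) 0 0 = 0) ->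
  M = M 0 0 *: J21.
Proof.
move=> iM; have ii : 'i * 'i = -1 :> C by rewrite -expr2 sqrCi.
have E x y : row3 x y 1 \in isotropic_rows ->
    (x * M 0 0 + y * M 1 0 + M ord_max 0) * x^* +
    (x * M 0 1 + y * M 1 1 + M ord_max 1) * y^* +
    (x * M 0 ord_max + y * M 1 ord_max + M ord_max ord_max) = 0.
  by move=> /iM; rewrite row3_form rmorph1 !mulr1 !mul1r.
have c1 : 1^* = 1 :> C by rewrite rmorph1.
have c0 : 0^* = 0 :> C by rewrite rmorph0.
have cN1 : (-1)^* = -1 :> C by rewrite rmorphN rmorph1.
have cq (p q : nat) : (p%:R / q%:R)^* = p%:R / q%:R :> C.
  by rewrite rmorphM fmorphV !rmorph_nat.
have [|||A1 M02 M20] := @phases3 (M 0 0 + M ord_max ord_max) (M 0 ord_max) (M ord_max 0).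
- by rewrite -[RHS](E 1 0) ?inE ?eqxx ?orbT// c1 c0; ring.
- by rewrite -[RHS](E (-1) 0) ?inE ?eqxx ?orbT// cN1 c0; ring.
- rewrite -[RHS](E 'i 0) ?inE ?eqxx ?orbT// conjCi c0.
  transitivity (- ('i * 'i) * M 0 0 + M ord_max ord_max +
    'i * M 0 ord_max - 'i * M ord_max 0); last by ring.
  by rewrite ii opprK mul1r.
have [|||A2 M12 M21] := @phases3 (M 1 1 + M ord_max ord_max) (M 1 ord_max) (M ord_max 1).
- by rewrite -[RHS](E 0 1) ?inE ?eqxx ?orbT// c1 c0; ring.
- by rewrite -[RHS](E 0 (-1)) ?inE ?eqxx ?orbT// cN1 c0; ring.
- rewrite -[RHS](E 0 'i) ?inE ?eqxx ?orbT// conjCi c0.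
  transitivity (- ('i * 'i) * M 1 1 + M ord_max ord_max +
    'i * M 1 ord_max - 'i * M ord_max 1); last by ring.
  by rewrite ii opprK mul1r.
have M00 : M 0 0 = - M ord_max ord_max by apply/eqP; rewrite -addr_eq0 A1.
have M11 : M 1 1 = - M ord_max ord_max by apply/eqP; rewrite -addr_eq0 A2.
have n12 : (12 / 25 : C) != 0 by rewrite mulf_neq0 ?invr_neq0 ?pnatr_eq0.
have S1 : M 0 1 + M 1 0 = 0.
  apply: (mulfI n12); rewrite mulr0.
  rewrite -[RHS](E (3 / 5) (4 / 5)) ?inE ?eqxx ?orbT// !cq M02 M20 M12 M21 M00 M11.
  by field.
have S2 : 'i * (M 1 0 - M 0 1) = 0.
  apply: (mulfI n12); rewrite mulr0.
  rewrite -[RHS](E (3 / 5) (4 / 5 * 'i)) ?inE ?eqxx ?orbT//.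
  rewrite [X in _ + _ * X + _]rmorphM /= conjCi !cq M02 M20 M12 M21 M00 M11.
  transitivity (12 / 25 * ('i * (M 1 0 - M 0 1)) +
    16 / 25 * (1 + 'i * 'i) * M ord_max ord_max); first by rewrite ii; ring.
  by field.
move/eqP: S2; rewrite mulf_eq0 (negPf (neq0Ci C)) /= subr_eq0 => /eqP S2.
have M01 : M 0 1 = 0.
  have : 2 * M 0 1 = 0 by rewrite -S1 S2; ring.
  by move/eqP; rewrite mulf_eq0 pnatr_eq0 /= => /eqP.
have M10 : M 1 0 = 0 by rewrite S2.
have M22 : M ord_max ord_max = - M 0 0 by rewrite M00 opprK.
have o0 h : @Ordinal 3 0 h = 0 by apply/val_inj.
have o1 h : @Ordinal 3 1 h = 1 by apply/val_inj.
have o2 h : @Ordinal 3 2 h = ord_max by apply/val_inj.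
apply/matrixP => -[[|[|[|//]]] hi] -[[|[|[|//]]] hj]; rewrite !mxE ?o0 ?o1 ?o2 /=
  ?M01 ?M10 ?M02 ?M20 ?M12 ?M21 ?mulr0n ?mulr1n ?mulr0 ?mulr1 ?mulrN1 ?M22 ?M11 ?M22 ?opprK //.
Qed.

End Isotropic.

(** * The centralizer of a complex reflection *)

Section Reflections.
Variables (C : numClosedFieldType) (n : nat) (H : 'M[C]_n).
Hypotheses (HU : H \in unitmx) (Hh : H ^t* = H).
Implicit Types (r : 'M[C]_n) (x y v : 'rV[C]_n).

Lemma adjmx_full_eq0 (W E : 'M[C]_n) x : (1%:M <= W + E)%MS ->
  x *m W ^t* = 0 -> x *m E ^t* = 0 -> x = 0.
Proof.
case/sub_addsmxP => -[A B] /= e xW xE; have : x *m (1%:M) ^t* = 0.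
  by rewrite e adjmxD 2!adjmxM mulmxDr 2!mulmxA xW xE !mul0mx addr0.
by rewrite adjmx1 mulmx1.
Qed.

Lemma form_conj x y : (y *m H *m x ^t*) 0 0 = ((x *m H *m y ^t*) 0 0)^*.
Proof.
have <- : (x *m H *m y ^t*) ^t* = y *m H *m x ^t*.
  by rewrite !adjmxM trmxCK Hh mulmxA.
by rewrite !mxE.
Qed.

Let h x y := (x *m H *m y ^t*) 0 0.

Lemma formDl x x' y : h (x + x') y = h x y + h x' y.
Proof. by rewrite /h !mulmxDl mxE. Qed.

Lemma formZl k x y : h (k *: x) y = k * h x y.
Proof. by rewrite /h -!scalemxAl mxE. Qed.

Lemma formDr x y y' : h x (y + y') = h x y + h x y'.
Proof. by rewrite /h adjmxD mulmxDr mxE. Qed.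

Lemma formZr k x y : h x (k *: y) = k^* * h x y.
Proof. by rewrite /h adjmxZ -scalemxAr mxE. Qed.

(** Polarization, at [x + y] and at [x + 'i y]. *)
Lemma isotropic_orthogonal m (X : 'M[C]_(m, n)) :
  (forall x, (x <= X)%MS -> h x x = 0) ->
  forall x y, (x <= X)%MS -> (y <= X)%MS -> h x y = 0.
Proof.
move=> iX x y xX yX.
have e1 : h x y + h y x = 0.
  have := iX (x + y) (addmx_sub xX yX).
  by rewrite formDl !formDr (iX x)// (iX y)// add0r addr0.
have : 'i * (h y x - h x y) = 0.
  have := iX (x + 'i *: y) (addmx_sub xX (scalemx_sub _ yX)).
  rewrite formDl !formDr !formZl !formZr (iX x)// (iX y)// !mulr0 add0r addr0.
  by rewrite conjCi => <-; ring.
move/eqP; rewrite mulf_eq0 (negPf (neq0Ci C)) /= subr_eq0 => /eqP e2.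
have : 2 * h x y = 0 by rewrite -e1 e2; ring.
by move/eqP; rewrite mulf_eq0 pnatr_eq0 /= => /eqP.
Qed.

Definition orth_reflection y : 'M[C]_n :=
  1%:M - (2 / (y *m H *m y ^t*) 0 0) *: (H *m y ^t* *m y).

Lemma orth_reflectionE x y : x *m orth_reflection y =
  x - (2 * (x *m H *m y ^t*) 0 0 / (y *m H *m y ^t*) 0 0) *: y.
Proof.
rewrite /orth_reflection mulmxBr mulmx1 -scalemxAr !mulmxA.
by rewrite [x *m H *m _]mx11_scalar mul_scalar_mx scalerA !mxE mulrAC.
Qed.

Lemma unitary_orth_reflection y : (y *m H *m y ^t*) 0 0 != 0 ->
  unitary Num.conj H (orth_reflection y).
Proof.
move=> q0; apply: unitaryP => //.
have qq := form_conj y y; have yE := mx11_scalar (y *m H *m y ^t*).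
rewrite /orth_reflection; move: q0 qq yE; set q := (_ 0 0) => q0 qq yE.
rewrite adjmxB adjmx1 adjmxZ !adjmxM trmxCK Hh mulmxBl mul1mx -!scalemxAl.
rewrite mulmxBr mulmx1 mulmxBl -!scalemxAr -!scalemxAl !mulmxA.
rewrite -!(mulmxA (H *m y ^t*)) yE !mulmxA mul_mx_scalar -!scalemxAl !scalerA.
have -> : (2 / q)^* = 2 / q by rewrite fmorph_div /= -qq rmorph_nat.
rewrite -addrA -[RHS]addr0; congr (_ + _).
set X := H *m _ *m _ *m _.
by apply/matrixP => i j; rewrite !mxE; field.
Qed.

Lemma orth_reflection_comm r y : unitary Num.conj H r -> y *m r = y ->
  r *m orth_reflection y = orth_reflection y *m r.
Proof.
move=> /unitaryE[rU rH] yr; rewrite /orth_reflection mulmxBr mulmxBl mulmx1 mul1mx.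
rewrite -scalemxAr -scalemxAl -!mulmxA yr; congr (_ - _ *: _).
have yr' : r ^t* *m y ^t* = y ^t* by rewrite -adjmxM yr.
by rewrite -{1}yr' !mulmxA rH.
Qed.

Lemma orth_reflection_neq y1 y2 :
  (y1 *m H *m y1 ^t*) 0 0 != 0 -> (y2 *m H *m y2 ^t*) 0 0 != 0 ->
  (y1 *m H *m y2 ^t*) 0 0 != 0 -> (forall k, y2 != k *: y1) ->
  orth_reflection y1 *m orth_reflection y2 !=
  orth_reflection y2 *m orth_reflection y1.
Proof.
move=> q1 q2 q12 ind; apply/eqP => /(congr1 (mulmx y1)); rewrite !mulmxA.
rewrite (orth_reflectionE y1 y1) (orth_reflectionE y1 y2).
rewrite !mulmxBl -!scalemxAl !orth_reflectionE.
set a := (_ 0 0) in q1 *; set b := (_ 0 0) in q2 *; set c := (_ 0 0) in q12 *.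
set d := (_ 0 0); rewrite mulfK// => e.
have q12' : 2 * (2 * c / b) != 0.
  by rewrite !mulf_neq0 ?invr_neq0 ?pnatr_eq0.
apply: (negP (ind ((2 * (2 * c / b))^-1 * ((2 * c / b) * (2 * d / a))))).
apply/eqP.
apply: (scalerI q12'); rewrite scalerA (mulVKf q12').
apply/rowP => i; move/rowP/(_ i): e; rewrite !mxE => e.
apply/eqP; rewrite -subr_eq0; move/eqP: e; rewrite -subr_eq0 => /eqP <-.
by apply/eqP; ring.
Qed.

(** The two eigenspaces are orthogonal and span, so the form is nondegenerate on
    the fixed space of [r].  This has dimension at least 2, hence contains two
    orthogonal vectors [y1] and [y0] that are not isotropic.  The orthogonal
    reflections in [y1] and in a generic combination of [y1] and [y0] do not
    commute, while both commute with [r]. *)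
Lemma reflection_centralizer r (eta : C) :
  unitary Num.conj H r -> eta != 1 -> (1 < \rank (eigenspace r 1))%N ->
  (\rank (eigenspace r 1) + \rank (eigenspace r eta))%N = n ->
  exists b1 b2, [/\ unitary Num.conj H b1, unitary Num.conj H b2,
    r *m b1 = b1 *m r, r *m b2 = b2 *m r & b1 *m b2 != b2 *m b1].
Proof.
move=> rH eta1 W2 rWE; have /unitaryE[rU rK] := rH.
pose W := eigenspace r 1; pose E := eigenspace r eta.
have WE : W *m H *m E ^t* = 0.
  have Wr : W *m r = W by rewrite (eigenspaceP (submx_refl W)) scale1r.
  have Er : E *m r = eta *: E by exact/eigenspaceP/submx_refl.
  have : W *m H *m E ^t* = eta^* *: (W *m H *m E ^t*).
    by rewrite -[in LHS]rK !mulmxA Wr -mulmxA -adjmxM Er adjmxZ scalemxAr.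
  move/eqP; rewrite -subr_eq0 -{1}[_ *m E ^t*]scale1r -scalerBl scaler_eq0.
  by rewrite subr_eq0 eq_sym -(rmorph1 Num.conj) (inj_eq (can_inj conjCK))
    (negPf eta1) => /eqP.
have full : (1%:M <= W + E)%MS.
  rewrite sub1mx row_full_unit -row_free_unit /row_free; apply/eqP.
  have -> : \rank (W + E)%MS = \rank W + \rank E :> nat.
    apply/mxrank_disjoint_sum/eqP/rowV0P => x; rewrite sub_capmx.
    case/andP => /eigenspaceP + /eigenspaceP; rewrite scale1r => -> /eqP.
    rewrite -{1}[x]scale1r -subr_eq0 -scalerBl scaler_eq0 subr_eq0 eq_sym.
    by rewrite (negPf eta1) => /eqP.
  exact: rWE.
have fix1 y : (y <= W)%MS -> y *m r = y by move/eigenspaceP; rewrite scale1r.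
have {}W2 : (1 < \rank W)%N by []; clear rWE; clearbody W E.
have full0 X := @adjmx_full_eq0 W E X full.
have nondeg x : (x <= W)%MS -> (forall y, (y <= W)%MS -> h x y = 0) -> x = 0.
  move=> xW xy; have : x *m H = 0.
    apply: full0; last by case/submxP: xW => A ->; rewrite -!(mulmxA A) WE mulmx0.
    apply/rowP => j; rewrite [RHS]mxE -[RHS](xy (row j W) (row_sub j W)).
    rewrite /h [LHS]mxE [RHS]mxE; apply: eq_bigr => k _.
    by congr (_ * _); rewrite !mxE.
  by move=> /(congr1 (mulmx^~ (invmx H))); rewrite mulmxK// mul0mx.
have [y1 y1W q1] : exists2 y1, (y1 <= W)%MS & h y1 y1 != 0.
  apply: contrapT => no; suff W0 : W == 0 by move: W2; rewrite (eqP W0) mxrank0.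
  apply/eqP/row_matrixP => j; rewrite row0; apply: (nondeg _ (row_sub _ _)) => y yW.
  apply: (@isotropic_orthogonal _ W) => // [x xW|]; last exact: row_sub.
  by apply/eqP/negPn/negP => q; apply: no; exists x.
pose W1 := (W :&: kermx (H *m y1 ^t*))%MS.
have W1P x : (x <= W1)%MS = (x <= W)%MS && (h x y1 == 0).
  rewrite sub_capmx; congr (_ && _); apply/sub_kermxP/eqP; rewrite mulmxA.
    by rewrite /h => ->; rewrite mxE.
  by move=> e; rewrite [LHS]mx11_scalar; move: e; rewrite /h => ->; rewrite raddf0.
have [y0 y0W1 q0] : exists2 y0, (y0 <= W1)%MS & h y0 y0 != 0.
  apply: contrapT => no; suff W10 : W1 == 0.
    have := mxrank_mul_ker W (H *m y1 ^t*); rewrite -/W1 (eqP W10) mxrank0 addn0.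
    move=> e; have := rank_leq_col (W *m (H *m y1 ^t*)).
    by rewrite e leqNgt W2.
  apply/eqP/row_matrixP => j; rewrite row0; have jW1 := row_sub j W1.
  have := jW1; rewrite W1P => /andP[jW /eqP j1]; apply: (nondeg _ jW) => y yW.
  have -> : y = (y - (h y y1 / h y1 y1) *: y1) + (h y y1 / h y1 y1) *: y1.
    by rewrite subrK.
  rewrite formDr formZr j1 mulr0 addr0; apply: (@isotropic_orthogonal _ W1) => //.
    move=> x xW; apply/eqP/negPn/negP => q; apply: no; exists x => //.
  rewrite W1P; apply/andP; split.
    by rewrite addmx_sub// eqmx_opp scalemx_sub.
  by rewrite -scaleNr formDl formZl mulNr mulfVK// subrr.
have := y0W1; rewrite W1P => /andP[y0W /eqP y01].
have y10 : h y1 y0 = 0 by rewrite /h form_conj -/(h _ _) y01 rmorph0.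
have [e e0 q2] : exists2 e : C, e != 0 & h (y1 + e *: y0) (y1 + e *: y0) != 0.
  have hE e : h (y1 + e *: y0) (y1 + e *: y0) = h y1 y1 + e * e^* * h y0 y0.
    by rewrite formDl !formDr !formZl !formZr y01 y10; ring.
  have [s0|s0] := eqVneq (h y1 y1 + h y0 y0) 0.
    exists 2; rewrite ?pnatr_eq0// hE rmorph_nat.
    have -> : h y1 y1 + 2 * 2 * h y0 y0 = 3 * h y0 y0 by rewrite -[RHS]add0r -s0; ring.
    by rewrite mulf_neq0 ?pnatr_eq0.
  by exists 1; rewrite ?oner_neq0// hE rmorph1 !mul1r.
have y2W : ((y1 + e *: y0)%R <= W)%MS by rewrite addmx_sub// scalemx_sub.
exists (orth_reflection y1), (orth_reflection (y1 + e *: y0)); split.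
- exact: unitary_orth_reflection.
- exact: unitary_orth_reflection.
- exact: orth_reflection_comm (fix1 _ y1W).
- exact: orth_reflection_comm (fix1 _ y2W).
apply: orth_reflection_neq => // [|k].
  by rewrite -/(h _ _) formDr formZr y10 mulr0 addr0.
apply/eqP => /(congr1 (h^~ y0)); rewrite formDl !formZl y10 mulr0 add0r => /eqP.
by rewrite mulf_eq0 (negPf e0) (negPf q0).
Qed.

End Reflections.

(** * Scalar plus rank one matrices *)

Lemma finite_order_diagonalizable (C : numClosedFieldType) k (A : 'M[C]_k.+1) m :
  (0 < m)%N -> A ^+ m = 1 -> diagonalizable A.
Proof.
move=> m0 Am; apply/diagonalizableP.
have [rs rsE] := closed_field_poly_normal ('X^m - 1 : {poly C}).
have lc : lead_coef ('X^m - 1 : {poly C}) = 1.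
  by apply/eqP; rewrite -monicE -polyC1 monicXnsubC.
rewrite lc scale1r in rsE; exists rs.
  rewrite -(separable.separable_prod_XsubC rs) -rsE cyclotomic.separable_Xn_sub_1//.
  by rewrite pnatr_eq0 -lt0n.
rewrite -rsE; apply: mxminpoly_min.
by rewrite rmorphB rmorph1 rmorphXn /= horner_mx_X Am subrr.
Qed.

(** Two of the three eigenvalues coincide: if they were distinct, the centralizer
    would consist of matrices diagonal in a common basis. *)
Lemma scalar_plus_rank1 (C : numClosedFieldType) (A B1 B2 : 'M[C]_3) m :
  (0 < m)%N -> A ^+ m = 1 -> A *m B1 = B1 *m A -> A *m B2 = B2 *m A ->
  B1 *m B2 != B2 *m B1 ->
  exists (a : C) (w : 'cV[C]_3) (u : 'rV[C]_3), A = a%:M + w *m u.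
Proof.
move=> m0 Am AB1 AB2 BB.
have [P PU PA] := finite_order_diagonalizable m0 Am.
have [d /(simmxRL PU) dE] := diagonalizable_forPex PA.
have AE : A = invmx P *m diag_mx d *m P by rewrite dE !mulmxA mulVmx// mul1mx mulmxKV.
have [i [j [ij dij]]] : exists i j, i != j /\ d 0 i = d 0 j.
  apply: contrapT => inj; move/eqP: BB; apply.
  have diagB B : A *m B = B *m A -> P *m B *m invmx P =
      diag_mx (\row_k (P *m B *m invmx P) k k).
    move=> AB; apply/matrixP => i j; rewrite [RHS]mxE [X in X *+ _]mxE.
    have [<-|ij] := eqVneq i j; first by rewrite mulr1n.
    rewrite mulr0n; have := congr1 (fun X : 'M[C]_3 => (P *m X *m invmx P) i j) AB.
    have -> : P *m (A *m B) *m invmx P = diag_mx d *m (P *m B *m invmx P).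
      by rewrite AE !mulmxA mulmxV// mul1mx.
    have -> : P *m (B *m A) *m invmx P = P *m B *m invmx P *m diag_mx d.
      by rewrite AE !mulmxA mulmxK.
    rewrite mul_diag_mx mul_mx_diag; set D := P *m B *m _; rewrite !(mxE _ (fun _ _ => _ * _)) mulrC => /eqP.
    rewrite -subr_eq0 -mulrBr mulf_eq0 subr_eq0 => /orP[/eqP//|/eqP e].
    by case: inj; exists i, j.
  have cP (X : 'M[C]_3) : X = invmx P *m (P *m X *m invmx P) *m P.
    by rewrite !mulmxA mulVmx// mul1mx mulmxKV.
  rewrite (cP (B1 *m B2)) (cP (B2 *m B1)); congr (_ *m _ *m _).
  have split X Y : P *m (X *m Y) *m invmx P = (P *m X *m invmx P) *m (P *m Y *m invmx P).
    by rewrite !mulmxA mulmxKV.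
  by rewrite !split (diagB _ AB1) (diagB _ AB2) diag_mxC.
have [k kP] : exists k : 'I_3, forall l, (l != k) -> d 0 l = d 0 i.
  have [k /andP[ki kj]] : exists k : 'I_3, (k != i) && (k != j).
    apply: contrapT => no.
    have := uniq_leq_size (s1 := enum 'I_3) (s2 := [:: i; j]) (enum_uniq _).
    rewrite size_enum_ord /= => le; suff : (3 <= 2)%N by [].
    apply: le => k _; apply: contrapT => kn; apply: no; exists k.
    by move/negP: kn; rewrite !inE negb_or.
  exists k => l lk; have [->//|li] := eqVneq l i; have [->//|lj] := eqVneq l j.
  have U : uniq [:: i; j; k; l].
    by rewrite /= !inE !negb_or ij (eq_sym i k) ki (eq_sym i l) li
      (eq_sym j k) kj (eq_sym j l) lj (eq_sym k l) lk.
  have := uniq_leq_size (s2 := enum 'I_3) U.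
  by rewrite size_enum_ord => /(_ (fun x _ => mem_enum _ x)).
exists (d 0 i), ((d 0 k - d 0 i) *: col k (invmx P)), (row k P).
rewrite AE; have -> : diag_mx d = (d 0 i)%:M + (d 0 k - d 0 i) *: delta_mx k k.
  apply/matrixP => x y; rewrite !mxE.
  have [->|xk] := eqVneq x k; last by rewrite (kP _ xk) mulr0 addr0.
  have [->|ky] := eqVneq k y; first by rewrite ?eqxx !mulr1n mulr1 addrC subrK.
  by rewrite ?(negPf ky) ?[y == k]eq_sym ?(negPf ky) !mulr0n mulr0 addr0.
rewrite mulmxDr mulmxDl mul_mx_scalar -scalemxAl mulVmx// scalemx1; congr (_ + _).
rewrite -scalemxAr -!scalemxAl; congr (_ *: _).
by rewrite -(mul_delta_mx (0 : 'I_1)) mulmxA -colE -mulmxA -rowE.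
Qed.

(** [(Y - X) A = A X - X A], and the scalar part of [A] drops out of the
    commutator, which has rank at most 2. *)
Lemma rank1_commutator_singular (C : fieldType) (A X Y : 'M[C]_3) a
    (w : 'cV[C]_3) (u : 'rV[C]_3) :
  A = a%:M + w *m u -> A *m X = Y *m A -> A \in unitmx -> Y - X \notin unitmx.
Proof.
move=> AE AX AU; apply/negP => YXU.
have : \rank ((Y - X) *m A) = 3%N by rewrite mxrank_unit// unitmx_mul YXU.
have -> : (Y - X) *m A = w *m (u *m X) - X *m w *m u.
  by rewrite mulmxBl -AX AE mulmxDl mulmxDr scalar_mxC opprD addrACA subrr add0r !mulmxA.
have r1 (c : 'cV[C]_3) (b : 'rV[C]_3) : (\rank (c *m b) <= 1)%N.
  exact: leq_trans (mxrankM_maxl _ _) (rank_leq_col _).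
have := leq_trans (mxrank_add (w *m (u *m X)) (- (X *m w *m u)))
  (leq_add (r1 _ _) (eq_leq (mxrank_opp _))).
by move=> + e; rewrite e addSn ltnS => /leq_trans/(_ (r1 _ _)).
Qed.

(** [B] commutes with the rank one matrix [w *m u], so it preserves its row
    space, the line of [u]. *)
Lemma rank1_common_eigenvector (C : fieldType) n (A B : 'M[C]_n) a
    (w : 'cV[C]_n) (u : 'rV[C]_n) :
  A = a%:M + w *m u -> w != 0 -> A *m B = B *m A -> exists c, u *m B = c *: u.
Proof.
move=> -> w0; rewrite mulmxDl mulmxDr scalar_mxC => /addrI e.
have [i wi] : exists i, w i 0 != 0.
  apply: contrapT => no; case/negP: w0; apply/eqP/colP => i; rewrite mxE.
  by apply/eqP/negPn/negP => wi; apply: no; exists i.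
exists ((B *m w) i 0 / w i 0); apply: (scalerI wi).
rewrite scalerA mulrC mulfVK//; move/(congr1 (row i)): e.
rewrite -mulmxA (mulmxA B) !row_mul.
by rewrite [row i w]mx11_scalar [row i B *m w]mx11_scalar !mul_scalar_mx -row_mul !mxE.
Qed.

(** * Commutators in the division algebra *)

Lemma finite_roots (F : closedFieldType) (p : {poly F}) : p != 0 ->
  finite_set [set x | root p x].
Proof.
move=> p0; have [rs pE] := closed_field_poly_normal p.
apply: (sub_finite_set _ (finite_seq rs)) => x /=.
by rewrite {1}pE rootZ ?lead_coef_eq0// root_prod_XsubC.
Qed.

Lemma finite_inj_image (T : choiceType) (T' : Type) (f : T -> T') (A : set T) (B : set T') :
  (forall x y, A x -> A y -> f x = f y -> x = y) -> (forall x, A x -> B (f x)) ->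
  finite_set B -> finite_set A.
Proof.
move=> fI fAB Bf; have : finite_set (f @` A).
  by apply: sub_finite_set Bf => _ [x Ax <-]; exact: fAB.
have [->|/set0P[a _]] := eqVneq A set0; first by move=> _; exact: finite_set0.
move=> fAf; pose g y := xget a [set x | A x /\ f x = y].
apply: (sub_finite_set _ (finite_image g fAf)) => x Ax; exists (f x); first by exists x.
rewrite /g; case: xgetP => [y _ [Ay /fI]|/(_ x) []//]; exact.
Qed.

Section Commutators.
Variables (C : numClosedFieldType) (H : 'M[C]_3).
Variables (D : unitRingType) (ext : {rmorphism D -> 'M[C]_3}).
Hypothesis Ddiv : forall x : D, x != 0 -> x \is a GRing.unit.
Variable phi : 'M[C]_3 -> 'M[C]_3.
Let U := unitary Num.conj H.
Hypothesis phiM : forall x y, U x -> U y -> phi (x * y) = phi x * phi y.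
Hypothesis phi1 : phi 1 = 1.
Hypothesis phi_inj : forall x y, U x -> U y -> phi x = phi y -> x = y.

(** The elements that [phi] carries into [D], up to the scalars of modulus 1 that
    are lost in passing to the projective group. *)
Definition division_part : set 'M[C]_3 :=
  [set x | U x /\ exists z d, `|z| = 1 /\ phi (z *: x) = ext d].

Let S := division_part.

Let Uunit x : U x -> x \is a GRing.unit. Proof. by case/unitaryE. Qed.
Let U1 : U 1. Proof. exact: unitary1. Qed.
Let UM x y : U x -> U y -> U (x * y). Proof. exact: unitaryM. Qed.
Let UV x : U x -> U x^-1. Proof. exact: unitaryV. Qed.

Lemma phi_unit x : U x -> phi x \is a GRing.unit.
Proof.
move=> Ux; apply/unitrP; exists (phi x^-1).
by rewrite -!phiM ?mulVr ?mulrV ?Uunit//; exact: UV.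
Qed.

Lemma phiV x : U x -> phi x^-1 = (phi x)^-1.
Proof.
move=> Ux; apply: (mulrI (phi_unit Ux)); rewrite mulrV ?phi_unit//.
by rewrite -phiM ?mulrV ?Uunit//; exact: UV.
Qed.

Lemma phiJ g x : U g -> U x -> phi (g * x / g) = phi g * phi x / phi g.
Proof. by move=> Ug Ux; rewrite !phiM ?phiV//; [exact: UM|exact: UV]. Qed.

Lemma ext_unit x d : U x -> phi x = ext d -> d \is a GRing.unit.
Proof.
move=> Ux e; apply: Ddiv; apply: contraTneq (phi_unit Ux) => d0.
by rewrite e d0 rmorph0 unitr0.
Qed.

Lemma division_partM x y : S x -> S y -> S (x * y).
Proof.
move=> [Ux [z [d [z1 e]]]] [Uy [z' [d' [z'1 e']]]]; split; first exact: UM.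
exists (z * z'), (d * d'); rewrite normrM z1 z'1 mulr1; split=> //.
rewrite rmorphM /= -e -e' -phiM; [|exact: unitaryZ|exact: unitaryZ].
by rewrite -scalerAl -scalerAr scalerA.
Qed.

Lemma norm1_unit (z : C) : `|z| = 1 -> z \is a GRing.unit.
Proof. by rewrite unitfE -normr_eq0 => ->; exact: oner_neq0. Qed.

Lemma division_partV x : S x -> S x^-1.
Proof.
move=> [Ux [z [d [z1 e]]]]; split; first exact: UV.
have Uzx : U (z *: x) by exact: unitaryZ.
exists z^-1, d^-1; split; first by rewrite normfV z1 invr1.
by rewrite -invrZ ?norm1_unit ?Uunit// phiV// e rmorphV//; exact: ext_unit e.
Qed.

Definition commutator (x y : 'M[C]_3) := x * y / x / y.

Lemma commutatorJ g x y : g \is a GRing.unit -> x \is a GRing.unit ->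
  y \is a GRing.unit ->
  commutator (g * x / g) (g * y / g) = g * commutator x y / g.
Proof.
move=> gU xU yU; have JV a : a \is a GRing.unit -> (g * a / g)^-1 = g * a^-1 / g.
  by move=> aU; rewrite !invrM ?unitrMl ?unitrV// invrK mulrA.
by rewrite /commutator !JV// !mulrA !mulrVK.
Qed.

(** Scalars cancel in a commutator, so that it comes from [D] itself. *)
Lemma phi_commutator x y : S x -> S y -> exists c, phi (commutator x y) = ext c.
Proof.
move=> [Ux [z [d [z1 e]]]] [Uy [z' [d' [z'1 e']]]].
have Uzx : U (z *: x) by exact: unitaryZ.
have Uzy : U (z' *: y) by exact: unitaryZ.
exists (d * d' / d / d').
have -> : commutator x y = commutator (z *: x) (z' *: y).
  rewrite /commutator !invrZ ?norm1_unit ?Uunit//.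
  rewrite -!(scalerAl, scalerAr) !scalerA.
  rewrite [X in X *: _](_ : _ = 1) ?scale1r//.
  by field; rewrite -!unitfE !norm1_unit.
rewrite /commutator !phiM ?phiV ?e ?e' ?rmorphM ?rmorphV//;
  do ?[exact: UM | exact: UV | exact: ext_unit e | exact: ext_unit e'].
  by apply: (UM _ (UV Uzx)); exact: UM.
Qed.

Variables (r : 'M[C]_3) (a : C) (w : 'cV[C]_3) (u : 'rV[C]_3).
Hypothesis Ur : U r.
Hypothesis phi_r : phi r = a%:M + w *m u.

(** Conjugation by [r] need not preserve [division_part]; this is the part that it
    carries into [division_part]. *)
Definition stable_part : set 'M[C]_3 := [set x | S x /\ S (r * x / r)].
Let L := stable_part.

Let LU x : L x -> U x. Proof. by case=> -[]. Qed.

Lemma stable_partM x y : L x -> L y -> L (x * y).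
Proof.
move=> [Sx Sx'] [Sy Sy']; split; first exact: division_partM.
by have := division_partM Sx' Sy'; rewrite !mulrA mulrVK// Uunit.
Qed.

Lemma stable_partV x : L x -> L x^-1.
Proof.
move=> Lx; have [Sx Sx'] := Lx; split; first exact: division_partV.
have := division_partV Sx'.
have Ux := Uunit (LU Lx); have rU := Uunit Ur.
by rewrite !invrM ?unitrMl ?unitrV// invrK mulrA.
Qed.

(** Put [rho = phi r].  Conjugation by [rho] sends the image of a commutator to an
    element of [D], and the difference of the two is singular because [rho] is a
    scalar plus a rank one matrix.  In a division ring this difference vanishes. *)
Lemma commutator_comm x y : L x -> L y -> r * commutator x y = commutator x y * r.
Proof.
move=> Lx Ly; have [Sx Sx'] := Lx; have [Sy Sy'] := Ly.
have Ux := LU Lx; have Uy := LU Ly.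
have [c cE] := phi_commutator Sx Sy; have [c' c'E] := phi_commutator Sx' Sy'.
have Un : U (commutator x y).
  by apply: (UM _ (UV Uy)); apply: (UM _ (UV Ux)); exact: UM.
rewrite commutatorJ ?Uunit// phiJ// cE in c'E.
have e : phi r *m ext c = ext c' *m phi r.
  by rewrite -c'E -[RHS]/(_ * _) mulrVK ?phi_unit.
have := rank1_commutator_singular phi_r e (phi_unit Ur).
rewrite -rmorphB; have [/eqP|nz] := eqVneq (c' - c) 0.
  rewrite subr_eq0 => /eqP cc' _; rewrite cc' -cE -phiJ// in c'E.
  have /(congr1 ( *%R^~ r)) := phi_inj (UM (UM Ur Un) (UV Ur)) Un c'E.
  by rewrite mulrVK ?Uunit.
by move/negP; case; exact: (rmorph_unit ext (Ddiv nz)).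
Qed.

(** All the conjugates of a commutator under [stable_part] have [u] as an
    eigenvector; as [D] is a division ring its eigenvalue determines the
    conjugate, and it is an eigenvalue of the given commutator. *)
Lemma finite_conjugates_commutator x y : w *m u != 0 -> L x -> L y ->
  finite_set [set g * commutator x y / g | g in L].
Proof.
move=> wu0 Lx Ly.
have w0 : w != 0 by apply: contraNneq wu0 => ->; rewrite mul0mx.
have u0 : u != 0 by apply: contraNneq wu0 => ->; rewrite mulmx0.
have [j uj] : exists j, u 0 j != 0.
  apply: contrapT => no; case/negP: u0; apply/eqP/rowP => j; rewrite mxE.
  by apply/eqP/negPn/negP => uj; apply: no; exists j.
set n := commutator x y; set A := [set _ | _ in _].
have Un : U n.
  by apply: (UM _ (UV (LU Ly))); apply: (UM _ (UV (LU Lx))); apply: UM; exact: LU.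
have key m : A m -> [/\ U m, (exists c, phi m = ext c) &
    exists2 k, u *m phi m = k *: u & root (char_poly (phi n)) k].
  move=> [g Lg <-]; have Ug := LU Lg; have Um := UM (UM Ug Un) (UV Ug).
  have gn : g * n / g = commutator (g * x / g) (g * y / g).
    by rewrite commutatorJ// Uunit//; exact: LU.
  have Lgx : L (g * x / g) by apply: stable_partM (stable_partV Lg); exact: stable_partM.
  have Lgy : L (g * y / g) by apply: stable_partM (stable_partV Lg); exact: stable_partM.
  split=> //; first by rewrite gn; apply: phi_commutator; [case: Lgx|case: Lgy].
  have : phi r *m phi (g * n / g) = phi (g * n / g) *m phi r.
    by rewrite -[LHS]/(_ * _) -[RHS]/(_ * _) -!phiM// gn commutator_comm.
  move/(rank1_common_eigenvector phi_r w0) => [k uk]; exists k => //.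
  rewrite -eigenvalue_root_char; apply/eigenvalueP; exists (u *m phi g).
    rewrite -mulmxA; have -> : phi g *m phi n = phi (g * n / g) *m phi g.
      by rewrite phiJ// -[RHS]/(_ * _) mulrVK ?phi_unit.
    by rewrite mulmxA uk -scalemxAl.
  apply: contraNneq u0 => e; rewrite -[u](mulmxK (phi_unit Ug)) e mul0mx//.
pose f m : C := (u *m phi m) 0 j / u 0 j.
have fE m : A m -> u *m phi m = f m *: u /\ root (char_poly (phi n)) (f m).
  by case/key => _ _ [k e rk]; rewrite /f e mxE mulfK.
apply: (@finite_inj_image _ _ f _ [set k | root (char_poly (phi n)) k]).
- move=> m m' Am Am' ff; have [Um [c ec] _] := key _ Am.
  have [Um' [c' ec'] _] := key _ Am'.
  apply: phi_inj => //; rewrite ec ec'; congr (ext _).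
  apply/eqP; rewrite -subr_eq0; apply/negPn/negP => /Ddiv/(rmorph_unit ext) cU.
  case/negP: u0; rewrite -[u](mulmxK cU) rmorphB mulmxBr -ec -ec'.
  by rewrite (fE _ Am).1 (fE _ Am').1 ff subrr mul0mx.
- by move=> m /fE[].
- exact/finite_roots/monic_neq0/char_poly_monic.
Qed.

(** If [r] commutes with [stable_part], it is the element sought.  Otherwise a
    nonscalar commutator will do, and if all commutators are scalar, then any
    nonscalar [x] in [stable_part] will: each conjugate is a multiple [c *: x],
    and the determinant forces [c ^+ 3 = 1]. *)
Lemma finite_conjugates_nonscalar : (forall c, r != c%:M) ->
  exists2 n, (forall c : C, n != c%:M) & finite_set [set g * n / g | g in L].
Proof.
move=> rN.
have [rL|rL] := pselect (forall g, L g -> r * g = g * r).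
  exists r => //; apply: (sub_finite_set _ (finite_set1 r)) => _ [g Lg <-] /=.
  by rewrite -rL// mulrK// Uunit//; exact: LU.
have wu0 : w *m u != 0.
  apply/eqP => wu; apply: rL => g Lg; have Ug := LU Lg.
  apply: phi_inj; [exact: UM|exact: UM|].
  rewrite !phiM// phi_r wu addr0.
  by rewrite -[LHS]/(_ *m _) -[RHS]/(_ *m _) scalar_mxC.
have [[x [y [Lx Ly nN]]]|allS] := pselect (exists x y,
    [/\ L x, L y & forall c, commutator x y != c%:M]).
  by exists (commutator x y) => //; exact: finite_conjugates_commutator.
have [[x Lx xN]|xS] := pselect (exists2 x, L x & forall c, x != c%:M); last first.
  case: rL => g Lg; have [c ->] : exists c, g = c%:M.
    apply: contrapT => no; apply: xS; exists g => // c.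
    by apply/eqP => e; apply: no; exists c.
  by rewrite -[LHS]/(_ *m _) -[RHS]/(_ *m _) scalar_mxC.
exists x => //; have Ux := LU Lx.
have X3 : 'X^3 - 1%:P != 0 :> {poly C} by rewrite monic_neq0// monicXnsubC.
apply: (sub_finite_set _ (finite_image (fun c => c *: x) (finite_roots X3))).
move=> _ [g Lg <-]; have Ug := LU Lg.
have [c cE] : exists c, commutator g x = c%:M.
  apply: contrapT => no; apply: allS; exists g, x; split=> // c.
  by apply/eqP => e; apply: no; exists c.
have e : g * x / g = c *: x.
  have : g * x / g = commutator g x * x by rewrite /commutator mulrVK// Uunit.
  by rewrite cE -[X in _ = X]/(_ *m _) mul_scalar_mx.
exists c => //=; rewrite /root !hornerE subr_eq0.
have := congr1 determinant e; rewrite detZ !det_mulmx mulrAC det_inv mulfV; last first.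
  by rewrite -unitfE -[_ \in _]/(g \in unitmx); exact: Uunit.
rewrite mul1r -[X in X = _]mul1r => /mulIf <-; rewrite ?eqxx//.
by rewrite -unitfE -[_ \in _]/(x \in unitmx); exact: Uunit.
Qed.

End Commutators.

(** * Dynamics on the quotient by a lattice *)

(** The dual of [(x, y, 1)] is [(x, y, -1) / 2]. *)
Lemma isotropic_rows_dual (C : numClosedFieldType) (v : 'rV[C]_3) :
  v \in isotropic_rows C -> v *m J21 C *m v ^t* = 0 /\
  exists v' : 'rV[C]_3, v' *m J21 C *m v' ^t* = 0 /\ v *m J21 C *m v' ^t* = 1%:M.
Proof.
have c0 : 0^* = 0 :> C by rewrite rmorph0.
have c1 : 1^* = 1 :> C by rewrite rmorph1.
have cN1 : (-1)^* = -1 :> C by rewrite rmorphN rmorph1.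
have ci : 'i * 'i^* = 1 :> C by rewrite conjCi mulrN -expr2 sqrCi opprK.
have cq (p q : nat) : (p%:R / q%:R)^* = p%:R / q%:R :> C.
  by rewrite rmorphM fmorphV !rmorph_nat.
move=> vL; have [x [y [-> xy]]] :
    exists x y, v = row3 x y 1 /\ x * x^* + y * y^* = 1.
  move: vL; rewrite /isotropic_rows !inE.
  do 7?[case/orP]; move=> /eqP ->; do 2!eexists; split=> //;
    rewrite ?[(4 / 5 * 'i)^*]rmorphM /= ?c0 ?c1 ?cN1 ?ci ?cq ?mulr0 ?mulrNN ?mulr1 ?addr0 ?add0r//.
  - by field.
  - by rewrite [X in _ + X]mulrACA ci; field.
have E (s t s' t' : C) : row3 (s * x) (s * y) t *m J21 C *m (row3 (s' * x) (s' * y) t') ^t* =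
    (s * s'^* - t * t'^*)%:M.
  rewrite [LHS]mx11_scalar row3_form !mxE /= !mulr1n !mulr0n !(mulr0, addr0, add0r, mulr1, mulrN1).
  rewrite !rmorphM /=; congr _%:M.
  transitivity (s * s'^* * (x * x^* + y * y^*) - t * t'^*); last by rewrite xy mulr1.
  by ring.
have e1 : row3 x y 1 = row3 (1 * x) (1 * y) 1 by rewrite !mul1r.
split; first by rewrite {1 2}e1 E c1 mulr1 subrr raddf0.
have c2 : (2^-1)^* = 2^-1 :> C by rewrite fmorphV rmorph_nat.
exists (row3 (2^-1 * x) (2^-1 * y) (- 2^-1)); split.
  by rewrite E rmorphN /= c2 mulrNN subrr raddf0.
rewrite {1}e1 E rmorphN /= c2 !mul1r opprK.
by congr _%:M; field.
Qed.

Section Topology.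
Variable R : realType.
Notation C := (Cplx R).

Lemma conj_continuous : continuous (Num.conj : C -> C).
Proof.
move=> x A /= /(nbhs_ballP (x^*)) [e e0 eA].
apply/nbhs_ballP; exists e => // y xy; apply: eA.
by rewrite /ball /= -rmorphB norm_conjC.
Qed.

Lemma open_norm_gt (c : C) : open [set z : C | c < `|z|].
Proof.
rewrite openE => z /= cz; apply/nbhs_ballP; exists (`|z| - c) => /=.
  by rewrite subr_gt0.
move=> y /=; rewrite /ball /= ltrBrDl -ltrBrDr => /lt_le_trans; apply.
by rewrite lerBlDr -{1}(subrK y z) addrC ler_normD.
Qed.

Lemma hermitian_value_continuous (v : 'rV[C]_3) (K : 'M[C]_3) :
  continuous (fun g : 'M[C]_3 => (v *m g *m K *m (v *m g) ^t*) 0 0 : C).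
Proof.
have vg i : continuous (fun g : 'M[C]_3 => (v *m g) 0 i : C).
  have -> : (fun g : 'M[C]_3 => (v *m g) 0 i : C) =
      (fun g => \sum_j v 0 j * g j i) by apply/funext => g; rewrite mxE.
  apply: continuous_big => [|j _]; first exact: add_continuous.
  move=> g; apply: (@continuousM C 'M[C]_3 (fun _ => v 0 j) (fun g : 'M[C]_3 => g j i)).
    exact: cst_continuous.
  exact: coord_continuous.
have -> : (fun g : 'M[C]_3 => (v *m g *m K *m (v *m g) ^t*) 0 0 : C) =
    (fun g => \sum_j (\sum_i (v *m g) 0 i * K i j) * ((v *m g) 0 j)^*).
  by apply/funext => g; rewrite mxE; apply: eq_bigr => j _; rewrite !mxE.
apply: continuous_big => [|j _]; first exact: add_continuous.
move=> g; apply: (@continuousM C 'M[C]_3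
  (fun g : 'M[C]_3 => \sum_i (v *m g) 0 i * K i j)
  (fun g : 'M[C]_3 => ((v *m g) 0 j)^*)).
  apply: (continuous_big (op := +%R)) => [|i _]; first exact: add_continuous.
  move=> {}g; apply: (@continuousM C 'M[C]_3 (fun g : 'M[C]_3 => (v *m g) 0 i)
    (fun _ => K i j)); first exact: vg.
  exact: cst_continuous.
apply: (continuous_comp (f := fun g : 'M[C]_3 => (v *m g) 0 j : C) (g := Num.conj)).
  exact: vg.
exact: conj_continuous.
Qed.

Lemma cplx_archimedean (x : C) : 0 <= x -> exists k, x < 4 ^+ k.
Proof.
move=> x0; have xr : x \is Num.real by exact: ger0_real.
have := complex.RRe_real (x := (x : R[i])) xr => xE.
have Re0 : 0 <= complex.Re (x : R[i]).
  by rewrite -(@lecR R) xE.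
exists (Num.bound (complex.Re (x : R[i]))).
have lt4 : complex.Re (x : R[i]) < 4 ^+ (Num.bound (complex.Re (x : R[i]))).
  apply: lt_le_trans (archi_boundP Re0) _.
  by rewrite -natrX ler_nat ltnW// ltn_expl.
by move: lt4; rewrite -(@ltcR R) xE rmorphXn /= rmorph_nat.
Qed.

End Topology.

Section Dynamics.
Variables (R : realType) (H : 'M[Cplx R]_3) (Lambda : set 'M[Cplx R]_3).
Notation C := (Cplx R).
Hypothesis sub : subgroup (U21 H) Lambda.
Notation q := (translate Lambda).

Lemma U21M a b : U21 H a -> U21 H b -> U21 H (a *m b).
Proof. exact: unitaryM. Qed.

Lemma U21V a : U21 H a -> U21 H (invmx a).
Proof. exact: unitaryV. Qed.

Lemma translate_eq g l : Lambda l -> q (g *m l) = q g.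
Proof.
have [LU _ LM LV] := sub.
move=> Ll; apply/seteqP; split=> [_ [x Lx <-]|_ [x Lx <-]].
  by exists (l *m x); [exact: LM|rewrite mulmxA].
exists (invmx l *m x); first by apply: LM => //; exact: LV.
by have /unitaryE[lU _] := LU _ Ll; rewrite mulmxA mulmxK.
Qed.

Lemma translate_inj g g' : q g = q g' -> exists2 l, Lambda l & g = g' *m l.
Proof.
have [_ L1 _ _] := sub.
move=> e; have : q g g by exists 1%:M => //; rewrite mulmx1.
by rewrite e => -[l Ll <-]; exists l.
Qed.

Lemma translateM a g : translate (q g) a = q (a *m g).
Proof.
apply/seteqP; split=> [_ [_ [x Lx <-] <-]|_ [x Lx <-]].
  by exists x => //; rewrite mulmxA.
by exists (g *m x); [exists x|rewrite mulmxA].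
Qed.

Definition hermitian_value (v : 'rV[C]_3) (K g : 'M[C]_3) : C :=
  (v *m g *m K *m (v *m g) ^t*) 0 0.

Lemma hermitian_valueM v K g l :
  hermitian_value v K (g *m l) = hermitian_value v (l *m K *m l ^t*) g.
Proof. by rewrite /hermitian_value !adjmxM !mulmxA. Qed.

(** [hermitian_value] does not descend to the quotient, so one takes the image of
    the set where it is large. *)
Definition large_values v K (c : C) : set (set 'M[C]_3) :=
  [set q g | g in [set g | U21 H g /\ c < `|hermitian_value v K g|]].

Lemma large_values_open v K c :
  Defs.quotient_open (U21 H) Lambda (large_values v K c).
Proof.
have [LU L1 LM LV] := sub; split; first by move=> _ [g [Ug _] <-]; exists g.
exists (\bigcup_(l in Lambda) [set g : 'M[C]_3 | c < `|hermitian_value v K (g *m l)|]).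
  apply: bigcup_open => l _.
  have cl : continuous (fun g : 'M[C]_3 => hermitian_value v K (g *m l) : C).
    under eq_fun do rewrite hermitian_valueM.
    exact: hermitian_value_continuous.
  by move/continuousP: cl => /(_ _ (@open_norm_gt _ c)).
apply/seteqP; split=> g [Ug]; last first.
  move=> [l Ll cg]; split=> //; exists (g *m l); last exact: translate_eq.
  by split; [exact: U21M Ug (LU _ Ll)|].
move=> [g' [Ug' cg'] /esym/translate_inj[l Ll e]]; split=> //.
have /unitaryE[lU _] := LU _ Ll.
exists (invmx l) => /=; first exact: LV.
by rewrite e mulmxK.
Qed.

Lemma large_values_translate v K c a (t : C) : t != 0 -> U21 H a -> v *m a = t *: v ->
  [set translate X a | X in large_values v K c] = large_values v K (`|t| ^+ 2 * c).
Proof.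
move=> t0 Ua va; have /unitaryE[aU _] := Ua.
have t2 : 0 < `|t| ^+ 2 by rewrite exprn_gt0// normr_gt0.
have E g : `|hermitian_value v K (a *m g)| = `|t| ^+ 2 * `|hermitian_value v K g|.
  rewrite /hermitian_value mulmxA va -!scalemxAl adjmxZ -scalemxAr scalerA mxE.
  by rewrite normrM normrM norm_conjC -expr2.
apply/seteqP; split=> [_ [_ [g [Ug cg] <-] <-]|_ [g [Ug cg] <-]].
  exists (a *m g); last by rewrite translateM.
  by split; [exact: U21M|rewrite E ltr_pM2l].
exists (q (invmx a *m g)); last by rewrite translateM mulKVmx.
have Uag := U21M (U21V Ua) Ug.
have := E (invmx a *m g); rewrite (mulKVmx aU g) => e.
have lt : c < `|hermitian_value v K (invmx a *m g)| by rewrite -(ltr_pM2l t2) -e.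
by exists (invmx a *m g).
Qed.

Notation borel_quotient := (g_sigma_algebraType (Defs.quotient_open (U21 H) Lambda)).

Variable nu : {measure set borel_quotient -> \bar R}.
Hypothesis nufin : (nu (quotient_space (U21 H) Lambda) < +oo)%E.
Hypothesis nuinv : forall g (A : set borel_quotient),
  U21 H g -> measurable A -> nu [set translate X g | X in A] = nu A.

Lemma measurable_quotient_open W : Defs.quotient_open (U21 H) Lambda W ->
  measurable (W : set borel_quotient).
Proof. exact: sub_sigma_algebra. Qed.

Lemma quotient_space_open :
  Defs.quotient_open (U21 H) Lambda (quotient_space (U21 H) Lambda).
Proof.
split=> //; exists setT; first exact: openT.
by apply/seteqP; split=> g [Ug _]; split=> //; exists g.
Qed.

(** The element [a] maps the set with threshold [c] onto the one with threshold
    [4 * c], so all the sets with threshold [4 ^+ k * c] have the same finite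
    measure.  They decrease, and their intersection is empty: finiteness of the
    conjugates of [n] bounds the values at all representatives of a given
    point. *)
Lemma large_values_null v n a (c : C) :
  finite_set [set g *m n *m invmx g | g in Lambda] ->
  U21 H a -> v *m a = 2 *: v -> 0 < c ->
  nu (large_values v (n *m H) c) = 0%E.
Proof.
move=> fin Ua va c0.
pose G k := large_values v (n *m H) (4 ^+ k * c).
have GO k : measurable (G k : set borel_quotient).
  by apply: measurable_quotient_open; exact: large_values_open.
have t4 : `|2 : C| ^+ 2 = 4 by rewrite normr_nat -natrX.
have GE k : nu (G k) = nu (G 0%N).
  elim: k => // k <-; rewrite -(nuinv Ua (GO k)).
  by rewrite (@large_values_translate _ _ _ _ 2)// t4 mulrA -exprS.
have G0E : G 0%N = large_values v (n *m H) c by rewrite /G expr0 mul1r.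
have cap : \bigcap_k G k = set0.
  apply/seteqP; split=> // X GX.
  have [g0 [Ug0 _] g0X] := GX 0%N I.
  pose V := [set `|hermitian_value v (l *m (n *m H) *m l ^t*) g0| | l in Lambda].
  have [M M0 VM] : exists2 M : C, 0 <= M & forall x, V x -> x <= M.
    have : finite_set V.
      pose f (m : 'M[C]_3) := `|hermitian_value v (m *m H) g0|.
      apply: (sub_finite_set _ (finite_image f fin)).
      move=> _ [l Ll <-]; exists (l *m n *m invmx l); first by exists l.
      have [LU _ _ _] := sub; have /unitaryE[lU lH] := LU _ Ll.
      by rewrite /f -{1}lH !mulmxA mulmxKV.
    move=> /finite_seqP[s sV]; exists (\sum_(x <- s) `|x|); first exact: sumr_ge0.
    move=> x Vx; have xs : x \in s by have := Vx; rewrite sV.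
    rewrite (big_rem x)//= ler_wpDr ?sumr_ge0// real_ler_norm//.
    by case: Vx => l _ <-; exact: normr_real.
  have [k Mk] := cplx_archimedean (divr_ge0 M0 (ltW c0)).
  have [g [Ug cg] gX] := GX k I.
  have [l Ll gE] : exists2 l, Lambda l & g = g0 *m l.
    by apply: translate_inj; rewrite gX g0X.
  move: cg; rewrite gE hermitian_valueM => cg.
  have VMl := VM `|hermitian_value v (l *m (n *m H) *m l ^t*) g0| (ex_intro2 _ _ l Ll erefl).
  have := lt_le_trans cg VMl; rewrite -ltr_pdivlMr// => /lt_trans/(_ Mk).
  by rewrite ltxx.
have GG0 : (nu (G 0%N) < +oo)%E.
  apply: le_lt_trans nufin; apply: le_measure; rewrite ?inE.
  - exact: GO.
  - exact: measurable_quotient_open quotient_space_open.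
  - by move=> _ [g [Ug _] <-]; exists g.
have mono : nonincreasing_seq G.
  move=> i j ij; apply/subsetPset => _ [g [Ug cg] <-]; exists g => //; split=> //.
  by apply: le_lt_trans cg; rewrite ler_pM2r// ler_weXn2l// ler1n.
have := @nonincreasing_cvg_mu _ _ _ nu G GG0 GO.
rewrite cap measure0 -G0E => /(_ measurable0 mono).
have -> : nu \o G = cst (nu (G 0%N)) by apply/funext => k; rewrite /= GE.
by move/(cvg_lim (@ereal_hausdorff R)); rewrite lim_cst.
Qed.

End Dynamics.

Lemma signature21_J21 (R : realType) (H : 'M[Cplx R]_3) : signature21 H ->
  [/\ H ^t* = H, H \in unitmx &
    exists2 P : 'M[Cplx R]_3, P \in unitmx & P *m H *m P ^t* = J21 _].
Proof.
move=> [/is_hermitianmxP hH [P PU PH]]; rewrite expr0 scale1r in hH.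
have JU : J21 (Cplx R) \in unitmx.
  rewrite unitmxE unitfE det_diag prodf_seq_neq0; apply/allP => i _ /=.
  by rewrite mxE; case: ifP => _; rewrite ?oppr_eq0 oner_neq0.
split=> //; last by exists P.
have : P *m (H *m (P ^t* *m invmx (J21 _))) = 1%:M by rewrite !mulmxA PH mulmxV.
move=> /mulmx1C; rewrite -mulmxA => /mulmx1_unit[]//.
Qed.

(** A weak form of Borel density.  Almost every point of the quotient has, for
    each of finitely many null vectors [v], value zero.  So there is one [g] for
    which [g n g^-1 H] vanishes on them, like [H] itself; then it is a multiple of
    [H], and [n] is scalar. *)
Lemma lattice_finite_conjugates (R : realType) (H : 'M[Cplx R]_3)
    (Lambda : set 'M[Cplx R]_3) (n : 'M[Cplx R]_3) :
  signature21 H -> lattice H Lambda ->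
  finite_set [set g *m n *m invmx g | g in Lambda] -> exists c, n = c%:M.
Proof.
move=> /signature21_J21[Hh HU [P PU PH]] [sub _ [nu [_ /andP[nu0 nufin] nuinv]]] fin.
pose v k := nth (row3 1 0 1) (isotropic_rows (Cplx R)) k *m P.
have vL k : nth (row3 1 0 1) (isotropic_rows (Cplx R)) k \in isotropic_rows (Cplx R).
  have [lt|ge] := ltnP k (size (isotropic_rows (Cplx R))); first exact: mem_nth.
  by rewrite nth_default// inE eqxx.
have null k c : 0 < c -> nu (large_values H Lambda (v k) (n *m H) c) = 0%E.
  move=> c0.
  have [iso [v' [iso' dual]]] := isotropic_rows_dual (vL k).
  have PE (x y : 'rV[Cplx R]_3) : (x *m P) *m H *m (y *m P) ^t* = x *m J21 _ *m y ^t*.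
    by rewrite -PH adjmxM !mulmxA.
  have [a Ua va] := @isotropic_dilation _ _ H (v k) (v' *m P) HU Hh
     (etrans (PE _ _) iso) (etrans (PE _ _) iso') (etrans (PE _ _) dual).
  exact: (large_values_null sub nufin nuinv fin Ua va c0).
apply: contrapT => nN.
suff cover : quotient_space (U21 H) Lambda `<=`
    \bigcup_k \bigcup_j large_values H Lambda (v k) (n *m H) (4 ^+ j)^-1.
  have : nu.-negligible (quotient_space (U21 H) Lambda).
    apply: (@negligibleS _ _ _ nu _ _ cover).
    apply: negligible_bigcup => k; apply: negligible_bigcup => j.
    apply/negligibleP; last by apply: null; rewrite invr_gt0 exprn_gt0.
    by apply: measurable_quotient_open; exact: large_values_open.
  move/negligibleP => nuq; rewrite nuq ?ltxx// in nu0.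
  by apply: measurable_quotient_open; exact: quotient_space_open.
move=> _ [g Ug <-]; have /unitaryE[gU gH] := Ug.
have [[k nz]|z] := pselect (exists k, hermitian_value (v k) (n *m H) g != 0).
  have gt0 : 0 < `|hermitian_value (v k) (n *m H) g| by rewrite normr_gt0.
  have [j jP] := cplx_archimedean (ltW (etrans (invr_gt0 _) gt0)).
  exists k => //; exists j => //; exists g => //; split=> //.
  by rewrite -[ltRHS]invrK ltf_pV2// posrE ?exprn_gt0 ?invr_gt0.
case: nN; pose M := P *m g *m n *m H *m g ^t* *m P ^t*.
have ME : M = M 0 0 *: J21 _.
  apply: isotropic_rows_span => x xL; apply: contrapT => /eqP xM; apply: z.
  exists (index x (isotropic_rows (Cplx R))).
  have -> : v (index x (isotropic_rows (Cplx R))) = x *m P by rewrite /v nth_index.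
  have -> // : hermitian_value (x *m P) (n *m H) g = (x *m M *m x ^t*) 0 0.
  by rewrite /hermitian_value /M !adjmxM !mulmxA.
exists (M 0 0); move: (M 0 0) ME => c.
rewrite -PH -[X in c *: (P *m X *m _)]gH => e.
have PsU : P ^t* \in unitmx by rewrite map_unitmx unitmx_tr.
have gsU : g ^t* \in unitmx by rewrite map_unitmx unitmx_tr.
apply: (can_inj (mulKmx gU)); apply: (can_inj (mulKmx PU)).
apply: (can_inj (mulmxK HU)); apply: (can_inj (mulmxK gsU)).
apply: (can_inj (mulmxK PsU)).
by move: e; rewrite /M mul_mx_scalar -!scalemxAr -!scalemxAl !mulmxA.
Qed.

(** * Finite index *)

Lemma invmxM (C : fieldType) n (A B : 'M[C]_n.+1) : A \in unitmx -> B \in unitmx ->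
  invmx (A *m B) = invmx B *m invmx A.
Proof. exact: invrM. Qed.

Section Virtually.
Variable R : realType.
Notation C := (Cplx R).
Implicit Types A B S Gamma Lambda : set 'M[C]_3.

(** Finite index, as a colouring of [A] with finitely many colours such that
    elements of the same colour differ by an element of [B].  In this form it does
    not ask for [B] to be contained in [A], and passes to intersections and along
    chains. *)
Definition virtually_in A B : Prop :=
  exists (T : Type) (kappa : 'M[C]_3 -> T), finite_set (kappa @` A) /\
    forall a b, A a -> A b -> kappa a = kappa b -> B (invmx a *m b).

Lemma finite_index_virtually_in A B : A `<=` unitmx -> B 1%:M ->
  finite_index mulmx A B -> virtually_in A B.
Proof.
move=> AU B1 fin; exists (set 'M[C]_3), (fun a => [set a *m b | b in B]); split=> //.
move=> a b Aa _ e; have : [set b *m x | x in B] b by exists 1%:M => //; rewrite mulmx1.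
by rewrite -e => -[x Bx <-]; rewrite mulKmx//; exact: AU.
Qed.

Lemma virtually_in_transversal A B : virtually_in A B ->
  exists (T : Type) (kappa : 'M[C]_3 -> T) (rep : T -> 'M[C]_3),
    finite_set (kappa @` A) /\
    forall a, A a -> A (rep (kappa a)) /\ B (invmx (rep (kappa a)) *m a).
Proof.
move=> [T [k [kfin kP]]]; exists T, k, (fun t => xget 0 [set b | A b /\ k b = t]).
split=> // a Aa; case: xgetP => [b _ [Ab kb]|/(_ a)[]//].
by split=> //; exact: kP.
Qed.

Lemma virtually_in_trans A B S : A `<=` unitmx -> virtually_in A B ->
  virtually_in B S -> virtually_in A S.
Proof.
move=> AU /virtually_in_transversal[T [k [rep [kfin kP]]]] [T' [k' [k'fin k'P]]].
exists (T * T')%type, (fun a => (k a, k' (invmx (rep (k a)) *m a))); split.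
  apply: (sub_finite_set _ (finite_setX kfin k'fin)) => _ [a Aa <-].
  by split; [exists a|exists (invmx (rep (k a)) *m a) => //; exact: (kP _ Aa).2].
move=> a b Aa Ab [kab k'ab]; have [Ar Br] := kP _ Ab.
have := k'P _ _ (kP _ Aa).2 Br k'ab; rewrite kab.
have rU : rep (k b) \in unitmx by exact: AU.
have rVU : invmx (rep (k b)) \in unitmx by rewrite unitmx_inv.
have aU : a \in unitmx by exact: AU.
by rewrite (invmxM rVU aU) invmxK -mulmxA mulKVmx.
Qed.

Lemma virtually_in_conjugate A S r : A `<=` unitmx -> r \in unitmx ->
  (forall x, A x -> A (r *m x *m invmx r)) -> virtually_in A S ->
  virtually_in A [set x | S x /\ S (r *m x *m invmx r)].
Proof.
move=> AU rU rA [T [k [kfin kP]]].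
exists (T * T)%type, (fun a => (k a, k (r *m a *m invmx r))); split.
  apply: (sub_finite_set _ (finite_setX kfin kfin)) => _ [a Aa <-].
  by split; [exists a|exists (r *m a *m invmx r) => //; exact: rA].
move=> a b Aa Ab [kab kab']; split; first exact: kP.
have := kP _ _ (rA _ Aa) (rA _ Ab) kab'.
have aU := AU _ Aa.
by rewrite !invmxM ?unitmx_mul ?unitmx_inv ?rU// invmxK !mulmxA mulmxKV.
Qed.

Lemma virtually_in_finite_conjugates A B n : A `<=` unitmx -> virtually_in A B ->
  finite_set [set g *m n *m invmx g | g in B] ->
  finite_set [set g *m n *m invmx g | g in A].
Proof.
move=> AU /virtually_in_transversal[T [k [rep [kfin kP]]]] Bfin.
have := finite_image2 (fun t m => rep t *m m *m invmx (rep t)) kfin Bfin.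
apply: sub_finite_set => _ [g Ag <-]; have [Ar Br] := kP _ Ag.
have rU := AU _ Ar; have gU := AU _ Ag.
exists (k g); first by exists g.
exists (invmx (rep (k g)) *m g *m n *m invmx (invmx (rep (k g)) *m g)).
  by exists (invmx (rep (k g)) *m g).
have rVU : invmx (rep (k g)) \in unitmx by rewrite unitmx_inv.
by rewrite (invmxM rVU gU) invmxK !mulmxA (mulmxV rU) mul1mx (mulmxK rU).
Qed.

End Virtually.

(** * Lattices of second type *)

Section SecondType.
Variables (R : realType) (F : fieldExtType rat) (E : fieldExtType F).
Variables (c : {rmorphism E -> E}) (D : falgType E) (tau : D -> D).
Hypothesis invol : involution_over c tau.
Variables (H' : 'M[D]_1) (iota : {rmorphism F -> R}) (X : real_extension tau 2 iota).
Notation C := (Cplx R).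
Let G' := real_unitary X H'.

Lemma tau1 : tau 1 = 1.
Proof.
case: invol => _ tauM tauK _.
by have := tauM (tau 1) 1; rewrite mulr1 tauK mulr1 => <-.
Qed.

Lemma real_unitary11 g :
  G' g <-> g 0 0 \is a GRing.unit /\ g 0 0 * extm X (H' 0 0) * extt X (g 0 0) = extm X (H' 0 0).
Proof.
have mx11P (A B : 'M['M[C]_3]_1) : A 0 0 = B 0 0 -> A = B.
  by move=> e; apply/matrixP => i j; rewrite !ord1.
have m11 (A B : 'M['M[C]_3]_1) : (A *m B) 0 0 = A 0 0 * B 0 0 by rewrite mxE big_ord1.
split=> [[[g' [gg' g'g]] gH]|[gU gH]].
  split.
    apply/unitrP; exists (g' 0 0); rewrite -!m11 gg' g'g mxE//.
  have := congr1 (fun A : 'M['M[C]_3]_1 => A 0 0) gH.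
  by rewrite !m11 !mxE.
split; last by apply: mx11P; rewrite !m11 !mxE.
exists (const_mx (g 0 0)^-1).
by split; apply: mx11P; rewrite m11 !mxE ?mulrV ?mulVr.
Qed.

Lemma real_unitaryM g1 g2 : G' g1 -> G' g2 -> G' (g1 *m g2).
Proof.
move=> /real_unitary11[u1 e1] /real_unitary11[u2 e2]; apply/real_unitary11.
rewrite mxE big_ord1; split; first by rewrite unitrMl.
have -> : extt X (g1 0 0 * g2 0 0) = extt X (g2 0 0) * extt X (g1 0 0).
  exact: exttM.
by rewrite !mulrA -(mulrA (g1 0 0)) -(mulrA (g1 0 0)) e2.
Qed.

Lemma arithmetic_group_real_unitary O g :
  arithmetic_group tau H' O g -> G' (map_mx (extm X) g).
Proof.
move=> [_ [g' [_ gg' g'g]] gH]; apply/real_unitary11; rewrite !mxE.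
split.
  apply/rmorph_unit/unitrP; exists (g' 0 0).
  have := congr1 (fun A : 'M[D]_1 => A 0 0) gg'.
  have := congr1 (fun A : 'M[D]_1 => A 0 0) g'g.
  by rewrite !mxE !big_ord1.
rewrite extt_tau -!rmorphM; congr (extm X _).
have := congr1 (fun A : 'M[D]_1 => A 0 0) gH.
by rewrite mxE big_ord1 !mxE big_ord1.
Qed.

Lemma arithmetic_group1 O : O 1 -> O 0 -> arithmetic_group tau H' O 1%:M.
Proof.
move=> O1 O0; have Oid i j : O ((1%:M : 'M[D]_1) i j) by rewrite mxE; case: (i == j).
split=> //; first by exists 1%:M; rewrite mulmx1.
rewrite mul1mx; apply/matrixP => i j; rewrite mxE big_ord1 !mxE !ord1 eqxx.
by rewrite tau1 mulr1.
Qed.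

Variables (H : 'M[C]_3) (f : 'M['M[C]_3]_1 -> 'M[C]_3) (f' : 'M[C]_3 -> 'M['M[C]_3]_1).
Hypothesis fbij : set_bij G' (U21 H) f.
Hypothesis fM : forall x y, G' x -> G' y -> f (x *m y) = f x *m f y.
Hypothesis fK : forall x, G' x -> f' (f x) = x.

(** The inverse of [f], as a map into 3 by 3 complex matrices.  It is used only
    as an injective morphism of abstract groups. *)
Let phi x := f' x 0 0.

Lemma phi_real_unitary x : U21 H x -> exists2 g, G' g & f g = x.
Proof. by case: fbij => _ _ /(_ x)/[apply]. Qed.

Lemma phi_morphism x y : U21 H x -> U21 H y -> phi (x * y) = phi x * phi y.
Proof.
move=> /phi_real_unitary[g Gg <-] /phi_real_unitary[h Gh <-].
have e : f g * f h = f (g *m h) by rewrite (fM Gg Gh).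
by rewrite /phi e (fK (real_unitaryM Gg Gh)) (fK Gg) (fK Gh) mxE big_ord1.
Qed.

Lemma phi_injective x y : U21 H x -> U21 H y -> phi x = phi y -> x = y.
Proof.
move=> /phi_real_unitary[g Gg <-] /phi_real_unitary[h Gh <-].
rewrite /phi (fK Gg) (fK Gh) => e; congr (f _).
by apply/matrixP => i j; rewrite !ord1.
Qed.

Lemma phi_one : phi 1 = 1.
Proof.
have U1 : U21 H 1 by exact: unitary1.
have [g Gg fg] := phi_real_unitary U1; have /real_unitary11[gU _] := Gg.
have pU : phi 1 \is a GRing.unit by rewrite /phi -fg fK.
by apply: (mulrI pU); rewrite mulr1 -phi_morphism// mulr1.
Qed.

(** Elements of [Gamma] whose classes lie in the same coset differ, up to a scalar
    of modulus 1, by the image under [f] of an element of the arithmetic group, on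
    which [phi] takes its value in [D]. *)
Lemma second_type_virtually_in O (Gamma : set 'M[C]_3) :
  subgroup (U21 H) Gamma -> is_order O ->
  finite_index (@pu_mul R) [set pu_class g | g in Gamma]
    ([set pu_class g | g in Gamma] `&`
     [set pu_class (f (map_mx (extm X) g)) | g in arithmetic_group tau H' O]) ->
  virtually_in Gamma (division_part H (extm X) phi).
Proof.
move=> [GU G1 GM GV] [ O1 OB _ _ _] fin.
have O0 : O 0 by have := OB _ _ O1 O1; rewrite subrr.
have AG1 := arithmetic_group1 O1 O0.
set PQ := _ `&` _ in fin.
have f1 : f (map_mx (extm X) 1%:M) = 1%:M.
  have G1' := arithmetic_group_real_unitary AG1.
  have : f (map_mx (extm X) 1%:M) \in unitmx.
    by case: fbij => /(_ _ G1')/unitaryE[].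
  move=> U1; apply: (can_inj (mulKmx U1)); rewrite mulmx1 -fM//.
  by rewrite -map_mxM mulmx1.
have PQ1 : PQ (pu_class 1%:M).
  by split; [exists 1%:M|exists 1%:M => //; rewrite f1].
have selfclass (x : 'M[C]_3) : pu_class x x by exists 1; rewrite /= ?normr1// scale1r.
exists (set (set 'M[C]_3)), (fun a => [set pu_mul (pu_class a) Y | Y in PQ]); split.
  apply: sub_finite_set fin => _ [a Ga <-]; exists (pu_class a) => //.
  by exists a.
move=> a b Ga Gb e.
have : [set pu_mul (pu_class b) Y | Y in PQ] (pu_mul (pu_class b) (pu_class 1%:M)).
  by exists (pu_class 1%:M).
rewrite -e => -[Y [_ [g AGg YE]] eY].
have : pu_mul (pu_class b) (pu_class 1%:M) b.
  by exists b => //; exists 1%:M => //; rewrite mulmx1.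
rewrite -eY -YE => -[x [z /= z1 <-]] [y [z' /= z'1 <-]] <-.
have /unitaryE[aU _] := GU _ Ga.
have -> : invmx a *m (z *: a *m (z' *: f (map_mx (extm X) g))) =
    (z * z') *: f (map_mx (extm X) g).
  by rewrite -scalemxAl -!scalemxAr scalerA !mulmxA mulVmx// mul1mx mulrC.
have Gg := arithmetic_group_real_unitary AGg.
have Ufg : U21 H (f (map_mx (extm X) g)) by case: fbij => /(_ _ Gg).
have zz1 : `|z * z'| = 1 by rewrite normrM z1 z'1 mulr1.
split; first exact: unitaryZ.
exists (z * z')^-1, (g 0 0); split; first by rewrite normfV zz1 invr1.
rewrite scalerA mulVf ?scale1r; last by rewrite -normr_eq0 zz1 oner_neq0.
by rewrite /phi fK// mxE.
Qed.

End SecondType.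

Lemma reflection_nonscalar (C : numClosedFieldType) (r : 'M[C]_3) (eta k : C) :
  eta != 1 -> \rank (eigenspace r 1) = 2%N -> \rank (eigenspace r eta) = 1%N ->
  r != k%:M.
Proof.
move=> eta1 r2 r1; apply/eqP => rk.
have val l : \rank (eigenspace r l) != 0%N -> k = l.
  rewrite mxrank_eq0 => /rowV0Pn[v /eigenspaceP]; rewrite rk mul_mx_scalar.
  move/eqP; rewrite -subr_eq0 -scalerBl scaler_eq0 subr_eq0 => /orP[/eqP//|/eqP->].
  by rewrite eqxx.
by case/negP: eta1; rewrite -(val eta) ?r1// (val 1) ?r2.
Qed.

(** The reflection enters by three properties: it is not scalar, it has finite
    order, and its centralizer is not abelian.  The last two survive the abstract
    isomorphism, so the image of the reflection is diagonalizable with a repeated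
    eigenvalue. *)
Lemma second_type_no_reflection (R : realType) (H : 'M[Cplx R]_3)
    (Gamma Lambda : set 'M[Cplx R]_3) :
  signature21 H -> lattice H Gamma -> lattice H Lambda ->
  commensurable mulmx Gamma Lambda ->
  (exists2 g, Lambda g & complex_reflection H g) ->
  ~ arithmetic_second_type H Gamma.
Proof.
move=> sH [Gsub _ _] LL [_ fiL] [r Lr [Ur [m m0 rm] _ r2 [eta [eta1 _ r1 _]]]].
case=> _ [F [E [c [D [tau [H' [_ _ _ [Ddiv _ _]]]]]]]].
case=> invol _ [iota [X [f [ O [_ [fbij fM _ [f' fK _]] Oord [fiG _]]]]]].
have [Lsub _ _] := LL; have [LU L1 LM LV] := Lsub; have [GU G1 GM GV] := Gsub.
have [Hh HU _] := signature21_J21 sH.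
have GunitU : Gamma `<=` unitmx by move=> x /GU/unitaryE[].
have LunitU : Lambda `<=` unitmx by move=> x /LU/unitaryE[].
pose phi x := f' x 0 0.
have phiM := phi_morphism fbij fM fK; have phiI := phi_injective fbij fK.
have phi1 := phi_one fbij fM fK.
have Gv := second_type_virtually_in invol fbij fM fK Gsub Oord fiG.
have Lv : virtually_in Lambda (division_part H (extm X) phi).
  apply: (@virtually_in_trans _ _ Gamma) => //.
  have := finite_index_virtually_in LunitU (conj G1 L1) fiL.
  by case=> T [k [kfin kP]]; exists T, k; split=> // x y Lx Ly /(kP _ _ Lx Ly)[].
have rU : r \in unitmx by have /unitaryE[] := Ur.
have rL x : Lambda x -> Lambda (r *m x *m invmx r).
  by move=> Lx; exact: (LM _ _ (LM _ _ Lr Lx) (LV _ Lr)).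
have Lv' := virtually_in_conjugate LunitU rU rL Lv.
have r12 : (1 < \rank (eigenspace r 1))%N by rewrite r2.
have rsum := congr2 addn r2 r1.
have [b1 [b2 [Ub1 Ub2 rb1 rb2 b12]]] := reflection_centralizer HU Hh Ur eta1 r12 rsum.
have phiX k : U21 H (r ^+ k) /\ phi (r ^+ k) = phi r ^+ k.
  elim: k => [|k [Uk IH]]; first by split; [exact: unitary1|exact: phi1].
  by rewrite !exprS -IH; split; [exact: (unitaryM Ur Uk)|exact: (phiM _ _ Ur Uk)].
have phirm : phi r ^+ m = 1 by rewrite -(phiX m).2 rm; exact: phi1.
have pcomm b : U21 H b -> r *m b = b *m r -> phi r *m phi b = phi b *m phi r.
  move=> Ub e; have e1 := phiM r b Ur Ub; have e2 := phiM b r Ub Ur.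
  by rewrite -[LHS]e1 -[RHS]e2; congr phi.
have pb12 : phi b1 *m phi b2 != phi b2 *m phi b1.
  apply: contraNneq b12 => e; apply/eqP.
  apply: (phiI _ _ (unitaryM Ub1 Ub2) (unitaryM Ub2 Ub1)).
  have e1 := phiM b1 b2 Ub1 Ub2; have e2 := phiM b2 b1 Ub2 Ub1.
  by rewrite [LHS]e1 [RHS]e2.
have [a [w [u phir]]] := scalar_plus_rank1 m0 phirm (pcomm _ Ub1 rb1) (pcomm _ Ub2 rb2) pb12.
have rN k := reflection_nonscalar k eta1 r2 r1.
have [n nN nfin] := finite_conjugates_nonscalar (extm X) Ddiv phiM phi1 phiI Ur phir rN.
have Lfin := virtually_in_finite_conjugates LunitU Lv' nfin.
have [k nk] := lattice_finite_conjugates sH LL Lfin.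
by case/eqP: (nN k).
Qed.

Theorem theorem1p4 (R : realType) (H : 'M[Cplx R]_3)
    (Gamma Lambda : set 'M[Cplx R]_3) :
  signature21 H ->
  lattice H Gamma ->
  lattice H Lambda ->
  commensurable mulmx Gamma Lambda ->
  (exists2 g, Lambda g & complex_reflection H g) ->
  arithmetic_first_type H Gamma \/ nonarithmetic H Gamma.
Proof.
move=> sH LG LL GL rL.
have [first|nfirst] := pselect (arithmetic_first_type H Gamma); first by left.
by right=> -[//|]; exact: second_type_no_reflection LL GL rL.
Qed.
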